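(* Let $\mu>0$ and $a_1,b_1,a_2,b_2\in\mathbb{R}$ with $a_1^2+b_1^2\neq 0$ and $a_2^2+b_2^2\neq 0$. Consider the hysteretic piecewise smooth vector field $Z=(X^+,X^-,HB)$ with $X^+=(a_1,b_1x)$, $X^-=(a_2,b_2)$ and hysteresis band $HB=\{(x,y)\in\mathbb{R}^2:-\mu\le y\le\mu\}$. Given an arbitrary initial condition $(x_0,y_0)\in\mathbb{R}^2$, the $\omega$-limit set of the trajectory of $Z$ through $(x_0,y_0)$ is of one of the following types: (1) $\{(\pm\infty,\pm\infty)\}$ (any choice of signs); (2) $\{(\pm\infty,M)\}$ or $\{(M,\pm\infty)\}$, where $M$ is a real constant; (3) a limit cycle intersecting $HB$; moreover, the stability of the limit cycle is completely determined by the visibility of the fold point of $X^+$, i.e., by the sign of $a_1b_1$; (4) a non-isolated periodic orbit intersecting $HB$; (5) $\{(\pm\infty,\text{zig-zag})\}$ or $\{(\text{zig-zag},\pm\infty)\}$, with the zig-zag occurring inside $HB$.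
   Context: Set $\Sigma^+=\{(x,y)\in\mathbb{R}^2: y\ge\mu\}$, $\Sigma^-=\{(x,y)\in\mathbb{R}^2: y\le-\mu\}$, $L^{\pm}=\{(x,y)\in\mathbb{R}^2:y=\pm\mu\}$. The field $X^+$ acts on $\Sigma^+$, the field $X^-$ acts on $\Sigma^-$, and both may act in $HB$, according to the following switching (hysteresis) rule. A trajectory starting at $(x_0,y_0)$ with $y_0>\mu$ follows $X^+$; a trajectory starting with $y_0\le\mu$ (in particular in $HB$, by convention) follows $X^-$. A trajectory following $X^+$ continues to do so until it reaches $L^-$ (if ever), at which moment it switches to $X^-$; a trajectory following $X^-$ continues to do so until it reaches $L^+$ from below (if ever), at which moment it switches to $X^+$; and so on indefinitely. (If $b_2\le0$, a trajectory following $X^-$ follows it forever.) Let $\overline{\mathbb{R}}=\mathbb{R}\cup\{\pm\infty\}$ and $\overline{\mathbb{R}}^2=\overline{\mathbb{R}}\times\overline{\mathbb{R}}$. The $\omega$-limit set of the trajectory $Z(t;x_0,y_0)$ is the set of all $(\omega_1,\omega_2)\in\overline{\mathbb{R}}^2$ such that $Z(t_n;x_0,y_0)\to(\omega_1,\omega_2)$ for some sequence $t_n\to+\infty$. A limit cycle is an isolated periodic orbit of $Z$; it may be the $\omega$-limit set of a trajectory other than itself. The notation $\{(\pm\infty,\text{zig-zag})\}$ means that the trajectory has a monotone zig-zag behavior inside $HB$: it crosses $HB$ back and forth between $L^+$ and $L^-$ infinitely often, with the $x$-coordinates of the successive crossings monotone and the $x$-coordinate tending to $+\infty$ or $-\infty$;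 $\{(\text{zig-zag},\pm\infty)\}$ is the analogous notation with the roles of the coordinates exchanged. When $a_1b_1\ne0$, $X^+$ has a fold point at $(0,\mu)\in L^+$; it is called visible if $a_1b_1>0$ and invisible if $a_1b_1<0$.
   Formalization: Trajectories that come to rest are excluded: if a1=0, X^+ vanishes on x=0, so e.g. from (0,2μ) the ω-limit set is one finite point, of none of the types. In (5), monotonicity of crossings is read separately on L^+ and on L^-, since alternating crossings need not be monotone. *)

(* Defs.v *)
(* Stdlib real numbers with Coquelicot. *)
From Stdlib Require Import Reals Arith.
From Coquelicot Require Import Coquelicot.
Open Scope R_scope.

(** * Hysteretic planar vector fields *)

(** The band is -mu <= y <= mu. *)
Record hysteretic := Hysteretic {
  Xplus : R * R -> R * R;
  Xminus : R * R -> R * R;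
  mu : R
}.

Inductive side := Plus | Minus.

Definition flip (s : side) : side :=
  match s with Plus => Minus | Minus => Plus end.

Definition field (H : hysteretic) (s : side) : R * R -> R * R :=
  match s with Plus => Xplus H | Minus => Xminus H end.

Definition in_HB (H : hysteretic) (p : R * R) : Prop :=
  - mu H <= snd p <= mu H.

(** Points where a trajectory following the field of side [s] must switch.
    A trajectory following X^- lives in y <= mu and reaches L^+ from below
    exactly when X^- points upward there.  In particular a trajectory starting
    on L^+ switches to X^+ at time 0 if X^- points upward, and keeps
    following X^- otherwise. *)
Definition switches (H : hysteretic) (s : side) (p : R * R) : Prop :=
  match s with
  | Plus => snd p = - mu H
  | Minus => snd p = mu H /\ 0 < snd (Xminus H p)
  end.

Definition initial_side (H : hysteretic) (p : R * R) : side :=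
  if Rlt_dec (mu H) (snd p) then Plus else Minus.

Definition nth_side (H : hysteretic) (p : R * R) (n : nat) : side :=
  Nat.iter n flip (initial_side H p).

(** [Z] follows the field of side [s] from time [a] to time [b], and [b] is the
    first time >= [a] at which it must switch ([p_infty] if there is none). *)
Definition leg (H : hysteretic) (s : side) (Z : R -> R * R)
    (a : R) (b : Rbar) : Prop :=
  (forall t, a < t -> Rbar_lt t b ->
     is_derive (fun u => fst (Z u)) t (fst (field H s (Z t))) /\
     is_derive (fun u => snd (Z u)) t (snd (field H s (Z t)))) /\
  (forall t, a <= t -> Rbar_lt t b -> ~ switches H s (Z t)) /\
  match b with
  | Finite b' => a <= b' /\ switches H s (Z b')
  | p_infty => True
  | m_infty => False
  end.

(** [Z] is the forward trajectory through [Z 0], and [m t] is the side whose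
    field it follows at time [t] (right-continuous in [t]); values at negative
    times are irrelevant.  The [tau n] are the successive switching times,
    [p_infty] once there are no more switches; they exhaust [0, +oo). *)
Definition trajectory (H : hysteretic) (Z : R -> R * R) (m : R -> side) : Prop :=
  continuous_on (fun t => 0 <= t) Z /\
  exists tau : nat -> Rbar,
    tau 0%nat = Finite 0 /\
    (forall n, match tau n with
               | Finite a => leg H (nth_side H (Z 0) n) Z a (tau (S n))
               | p_infty => tau (S n) = p_infty
               | m_infty => False
               end) /\
    (forall t, 0 <= t ->
       exists n, Rbar_le (tau n) t /\ Rbar_lt t (tau (S n))) /\
    (forall n t, Rbar_le (tau n) t -> Rbar_lt t (tau (S n)) ->
       m t = nth_side H (Z 0) n).

Definition comes_to_rest (Z : R -> R * R) : Prop :=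
  exists T, 0 <= T /\ forall t, T <= t -> Z t = Z T.

(** * Limit sets in the square of the extended line *)

Definition omega_limit (Z : R -> R * R) (w : Rbar * Rbar) : Prop :=
  exists t : nat -> R,
    is_lim_seq t p_infty /\
    is_lim_seq (fun n => fst (Z (t n))) (fst w) /\
    is_lim_seq (fun n => snd (Z (t n))) (snd w).

Definition omega_is (Z : R -> R * R) (A : Rbar * Rbar -> Prop) : Prop :=
  forall w, omega_limit Z w <-> A w.

Definition infinite (l : Rbar) : Prop := l = p_infty \/ l = m_infty.

Definition to_Rbar2 (p : R * R) : Rbar * Rbar := (Finite (fst p), Finite (snd p)).

(** * Periodic orbits *)

Definition orbit (Z : R -> R * R) (p : R * R) : Prop :=
  exists t, 0 <= t /\ Z t = p.

Definition orbit_in_Rbar2 (Z : R -> R * R) (w : Rbar * Rbar) : Prop :=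
  exists p, orbit Z p /\ w = to_Rbar2 p.

(** Equilibria are not periodic orbits. *)
Definition periodic_trajectory (H : hysteretic) (Z : R -> R * R)
    (m : R -> side) : Prop :=
  trajectory H Z m /\
  (exists T, 0 < T /\ forall t, 0 <= t -> Z (t + T) = Z t) /\
  (exists t, 0 <= t /\ Z t <> Z 0).

Definition near_orbit (Z : R -> R * R) (eps : R) (p : R * R) : Prop :=
  exists q, orbit Z q /\ ball q eps p.

(** Some neighbourhood of the orbit contains no other periodic orbit. *)
Definition isolated (H : hysteretic) (Zc : R -> R * R) : Prop :=
  exists eps, 0 < eps /\
    forall Z m, periodic_trajectory H Z m ->
      (forall p, orbit Z p -> near_orbit Zc eps p) ->
      forall p, orbit Z p <-> orbit Zc p.

Definition limit_cycle (H : hysteretic) (Zc : R -> R * R) (mc : R -> side) : Prop :=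
  periodic_trajectory H Zc mc /\ isolated H Zc.

Definition meets_HB (H : hysteretic) (Z : R -> R * R) : Prop :=
  exists p, orbit Z p /\ in_HB H p.

(** Inside the band the position does not determine the active field, so
    closeness of initial states is taken in the state space R^2 x {X^+, X^-}:
    a point close to the part of the cycle described by X^+ in the interior of
    the band nevertheless starts with X^-, and is not a small perturbation of
    the cycle. *)
Definition starts_near (Zc : R -> R * R) (mc : R -> side) (delta : R)
    (Z : R -> R * R) (m : R -> side) : Prop :=
  exists s, 0 <= s /\ ball (Zc s) delta (Z 0) /\ m 0 = mc s.

Definition stable (H : hysteretic) (Zc : R -> R * R) (mc : R -> side) : Prop :=
  forall eps, 0 < eps -> exists delta, 0 < delta /\
    forall Z m, trajectory H Z m -> starts_near Zc mc delta Z m ->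
      forall t, 0 <= t -> near_orbit Zc eps (Z t).

Definition asymptotically_stable (H : hysteretic) (Zc : R -> R * R)
    (mc : R -> side) : Prop :=
  stable H Zc mc /\
  exists delta, 0 < delta /\
    forall Z m, trajectory H Z m -> starts_near Zc mc delta Z m ->
      omega_is Z (orbit_in_Rbar2 Zc).

Definition unstable (H : hysteretic) (Zc : R -> R * R) (mc : R -> side) : Prop :=
  ~ stable H Zc mc.

(** * Zig-zags *)

(** From time [s 0] on, [v] crosses back and forth between [hi] and [lo], the
    crossings being the intervals between successive times [s n], while [u]
    tends to [l].  Monotonicity of [u] compares successive visits to the same
    edge (steps of 2): a crossing in one direction may partly undo the
    displacement produced by the previous crossing in the other direction. *)
Definition zigzag (u v : R -> R) (lo hi : R) (l : Rbar) : Prop :=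
  is_lim u p_infty l /\
  exists s : nat -> R,
    0 <= s 0%nat /\
    (forall n, s n < s (S n)) /\
    is_lim_seq s p_infty /\
    (forall n, v (s n) = if Nat.even n then hi else lo) /\
    (forall n t, s n < t < s (S n) -> lo < v t < hi) /\
    ((forall n, u (s n) <= u (s (S (S n)))) \/
     (forall n, u (s (S (S n))) <= u (s n))).

(** * The five types *)

Definition type1 (Z : R -> R * R) : Prop :=
  exists l1 l2, infinite l1 /\ infinite l2 /\ omega_is Z (fun w => w = (l1, l2)).

Definition type2 (Z : R -> R * R) : Prop :=
  exists (l : Rbar) (M : R), infinite l /\
    (omega_is Z (fun w => w = (l, Finite M)) \/
     omega_is Z (fun w => w = (Finite M, l))).

(** [visible] and [invisible] refer to the fold point of X^+. *)
Definition type3 (H : hysteretic) (visible invisible : Prop)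
    (Z : R -> R * R) : Prop :=
  exists Zc mc,
    limit_cycle H Zc mc /\ meets_HB H Zc /\ omega_is Z (orbit_in_Rbar2 Zc) /\
    ((invisible /\ asymptotically_stable H Zc mc) \/
     (visible /\ unstable H Zc mc)).

Definition type4 (H : hysteretic) (Z : R -> R * R) : Prop :=
  exists Zc mc,
    periodic_trajectory H Zc mc /\ ~ isolated H Zc /\ meets_HB H Zc /\
    omega_is Z (orbit_in_Rbar2 Zc).

Definition type5 (H : hysteretic) (Z : R -> R * R) : Prop :=
  let x := fun t => fst (Z t) in
  let y := fun t => snd (Z t) in
  (exists T, 0 <= T /\ forall t, T <= t -> in_HB H (Z t)) /\
  exists l, infinite l /\
    (zigzag x y (- mu H) (mu H) l \/
     exists lo hi, lo < hi /\ zigzag y x lo hi l).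

(** * The family X^+ = (a1, b1 x), X^- = (a2, b2) *)

Definition fold_constant (mu a1 b1 a2 b2 : R) : hysteretic :=
  Hysteretic (fun p => (a1, b1 * fst p)) (fun _ => (a2, b2)) mu.

Definition visible_fold (a1 b1 : R) : Prop := 0 < a1 * b1.
Definition invisible_fold (a1 b1 : R) : Prop := a1 * b1 < 0.

(* Main.v *)
Require Import Defs.
From Stdlib Require Import Reals Lra Psatz Lia Arith ClassicalEpsilon.
From Coquelicot Require Import Coquelicot.
Open Scope R_scope.

(** Both fields are integrated by polynomials in time, so the theorem is about
    the sequence of switches.

    If [b2 <= 0], the field [X^-] never leads up to [L^+]: there is at most one
    switch, and the last leg gives the limit set ([downward_types]).

    If [0 < b2], each stay in [X^-] ends on [L^+].  Either the trajectory follows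
    [X^+] forever from some time on, and the limit set is again that of one
    explicit leg ([above_forever_type]), or it touches [L^-] infinitely often
    ([trajectory_dichotomy]).  In the second case everything depends on the
    abscissae [w n] of the successive touchdowns.  One loop goes up from
    [(w n, - mu)] to [(w n + delta, mu)] and comes down along an arc of [X^+].

    Let [a1 <> 0].  In the coordinate [u = x / a1], with [v n = w n / a1] and
    [D = delta / a1], the field [X^+] conserves [y - a1 * b1 * u ^ 2 / 2].  Hence
    [v (n + 1) ^ 2 = (v n + D) ^ 2 + K] with [K = - 4 mu / (a1 b1)], and the sign of
    [a1 * b1] tells which of the two roots is reached.

    - Invisible fold.  The root is positive and [0 < K], and each arc comes down.
      If [0 <= D], the squares grow by at least [K] and the trajectory zig-zags to
      infinity.  If [D < 0], the return map has one fixed point [V] and brings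
      all points closer to it, at a rate that is uniform on bounded sets
      ([return_map_contracts]).  So all trajectories tend to one cycle, which is
      asymptotically stable.
    - Visible fold.  The root is negative and [K < 0].  If [0 <= D], the squares
      decrease by at least [- K] at each loop, so there are finitely many loops.
      If [D < 0], then [v (n + 1) ^ 2 - v n ^ 2 = 2 (- D) (V - v n)] for a constant
      [V]: a start beyond [V] is driven to infinity, a start inside is driven out
      of the set where the arc reaches [L^-], and a start at [V] is a cycle, which
      repels its neighbours.
    - [b1 = 0].  An arc of [X^+] is horizontal and never comes down.

    If [a1 = 0], the arcs are vertical and the return map is the translation by
    [delta]: a zig-zag if [delta <> 0], and if [delta = 0] a family of periodic
    vertical segments, none of which is isolated.

    Two results link touchdowns to orbits.  If the touchdowns and the durations of
    the arcs converge to those of a cycle, the limit set is its orbit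
    ([convergence_to_cycle]).  A cycle whose orbit is the limit set of all periodic
    trajectories is isolated ([isolated_of_attraction]).  The cycles, and the
    trajectories that witness instability and non-isolation, are built by gluing
    arcs ([laps_trajectory]). *)

(** * Real functions of time *)

Lemma ball_RR (p q : R * R) (e : R) :
  ball p e q <-> Rabs (fst q - fst p) < e /\ Rabs (snd q - snd p) < e.
Proof. destruct p, q; reflexivity. Qed.

Lemma continuity_pt_eps (f : R -> R) (x : R) :
  (forall eps, 0 < eps -> exists d, 0 < d /\
     forall y, Rabs (y - x) < d -> Rabs (f y - f x) < eps) ->
  continuity_pt f x.
Proof.
  intros Hf eps Heps. destruct (Hf eps Heps) as [d [Hd Hy]].
  exists d. split; [exact Hd|]. intros y [_ Hy']. exact (Hy y Hy').
Qed.

(** Extending by the value at 0 to negative times turns one-sided continuity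
    on [[0, +oo)] into continuity on the whole line, as the mean and extreme
    value theorems require. *)
Lemma continuity_clamped (Z : R -> R * R) :
  continuous_on (fun t => 0 <= t) Z ->
  continuity (fun t => fst (Z (Rmax 0 t))) /\
  continuity (fun t => snd (Z (Rmax 0 t))).
Proof.
  intros HZ.
  assert (Key : forall t eps, 0 < eps -> exists d, 0 < d /\
     forall y, Rabs (y - t) < d -> ball (Z (Rmax 0 t)) eps (Z (Rmax 0 y))).
  { intros t eps Heps.
    pose proof (HZ (Rmax 0 t) (Rmax_l 0 t)) as H.
    apply (proj1 (filterlim_locally (F := within _ (locally _)) Z (Z (Rmax 0 t)))) with
      (eps := mkposreal eps Heps) in H.
    destruct H as [d Hd]. exists d. split; [apply cond_pos|].
    intros y Hy. apply Hd; [|apply Rmax_l].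
    change (Rabs (Rmax 0 y - Rmax 0 t) < d).
    eapply Rle_lt_trans; [|exact Hy].
    unfold Rmax; destruct (Rle_dec 0 y), (Rle_dec 0 t);
      unfold Rabs; repeat destruct Rcase_abs; lra. }
  split; intros t; apply continuity_pt_eps; intros eps Heps;
    destruct (Key t eps Heps) as [d [Hd H]]; exists d; split; auto;
    intros y Hy; apply (H y Hy).
Qed.

Lemma constant_on_interval (f : R -> R) (a b : R) :
  a <= b -> (forall t, a <= t <= b -> continuity_pt f t) ->
  (forall t, a < t < b -> is_derive f t 0) -> f b = f a.
Proof.
  intros Hab Hc Hd.
  destruct (MVT_gen f a b (fun _ => 0)) as [c [_ E]].
  - rewrite Rmin_left, Rmax_right by lra. exact Hd.
  - rewrite Rmin_left, Rmax_right by lra. exact Hc.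
  - lra.
Qed.

Lemma eq_of_same_derivative (f g g' : R -> R) (a b : R) :
  a <= b -> continuity f -> (forall t, is_derive g t (g' t)) ->
  (forall t, a < t < b -> is_derive f t (g' t)) -> f a = g a -> f b = g b.
Proof.
  intros Hab Hf Hg Hfg E.
  assert (f b - g b = f a - g a); [|lra].
  apply (constant_on_interval (fun t => f t - g t)); auto.
  - intros t _. apply continuity_pt_minus; [apply Hf|].
    apply continuity_pt_filterlim.
    apply (ex_derive_continuous (K := R_AbsRing) (V := R_NormedModule)).
    exists (g' t). apply Hg.
  - intros t Ht. replace 0 with (minus (g' t) (g' t)) by (unfold minus, plus, opp; simpl; ring).
    apply (is_derive_minus f g); auto.
Qed.

Lemma stays_above (f : R -> R) (a b c : R) :
  continuity f -> c < f a -> a <= b -> (forall t, a <= t <= b -> f t <> c) ->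
  c < f b.
Proof.
  intros Hf Ha Hab Hne. destruct (Rlt_le_dec c (f b)) as [|Hle]; [assumption|].
  destruct (IVT_gen f a b c Hf) as [s [Hs E]].
  - rewrite Rmin_right, Rmax_left by lra. lra.
  - rewrite Rmin_left, Rmax_right in Hs by lra. exfalso. apply (Hne s); lra.
Qed.

(** * Legs and itineraries *)

Section Family.
Variables mu a1 b1 a2 b2 : R.

Notation H := (fold_constant mu a1 b1 a2 b2).

Definition flow (s : side) (p : R * R) (t : R) : R * R :=
  match s with
  | Plus => (fst p + a1 * t, snd p + b1 * fst p * t + a1 * b1 * t ^ 2 / 2)
  | Minus => (fst p + a2 * t, snd p + b2 * t)
  end.

Lemma flow_0 s p : flow s p 0 = p.
Proof. destruct s, p; simpl; f_equal; field. Qed.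

Lemma flow_add s p t u : flow s (flow s p t) u = flow s p (t + u).
Proof. destruct s; simpl; f_equal; field. Qed.

Lemma flow_derive s p t :
  is_derive (fun u => fst (flow s p u)) t (fst (field H s (flow s p t))) /\
  is_derive (fun u => snd (flow s p u)) t (snd (field H s (flow s p t))).
Proof. destruct s; simpl; split; auto_derive; auto; field. Qed.

(** The first component solves an autonomous scalar equation with constant
    right-hand side; once it is known, so is the right-hand side of the second. *)
Lemma leg_flow s (Z : R -> R * R) a b :
  continuous_on (fun t => 0 <= t) Z -> 0 <= a -> leg H s Z a b ->
  forall t, 0 <= t -> Rbar_le (a + t) b -> Z (a + t) = flow s (Z a) t.
Proof.
  intros HZ Ha [Hd _] t Ht Hb.
  destruct (continuity_clamped Z HZ) as [Cx Cy].
  assert (Hin : forall u v, 0 <= v -> v <= t -> a < u < a + v -> a < u /\ Rbar_lt u b).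
  { intros u v Hv Hv' Hu. split; [lra|]. eapply Rbar_lt_le_trans; [|exact Hb]. simpl. lra. }
  assert (Hloc : forall (f : R * R -> R) u l, a < u -> is_derive (fun v => f (Z v)) u l ->
            is_derive (fun v => f (Z (Rmax 0 v))) u l).
  { intros f u l Hu. apply is_derive_ext_loc.
    assert (Hu' : 0 < u) by lra. exists (mkposreal u Hu'). intros v Hv.
    rewrite Rmax_right; [reflexivity|].
    change (Rabs (v - u) < u) in Hv. apply Rabs_def2 in Hv. lra. }
  assert (Ex : forall v, 0 <= v -> v <= t ->
            fst (Z (a + v)) = fst (flow s (Z a) v)).
  { intros v Hv Hv'.
    pose proof (eq_of_same_derivative (fun u => fst (Z (Rmax 0 u)))
      (fun u => fst (flow s (Z a) (u - a)))
      (fun _ => match s with Plus => a1 | Minus => a2 end) a (a + v)) as E.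
    simpl in E. rewrite !Rmax_right in E by lra.
    replace (a + v - a) with v in E by ring. rewrite Rminus_diag, flow_0 in E.
    apply E; auto; [lra| |].
    - intros u. destruct s; simpl; auto_derive; auto; ring.
    - intros u Hu. apply (Hloc fst); [lra|].
      destruct (Hin u v Hv Hv' Hu) as [H1 H2].
      destruct (Hd u H1 H2) as [D _]. destruct s; exact D. }
  assert (Ey : snd (Z (a + t)) = snd (flow s (Z a) t)).
  { pose proof (eq_of_same_derivative (fun u => snd (Z (Rmax 0 u)))
      (fun u => snd (flow s (Z a) (u - a)))
      (fun u => snd (field H s (flow s (Z a) (u - a)))) a (a + t)) as E.
    simpl in E. rewrite !Rmax_right in E by lra.
    replace (a + t - a) with t in E by ring. rewrite Rminus_diag, flow_0 in E.
    apply E; auto; [lra| |].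
    - intros u. destruct s; simpl; auto_derive; auto; field.
    - intros u Hu. apply (Hloc snd); [lra|].
      destruct (Hin u t Ht (Rle_refl t) Hu) as [H1 H2].
      destruct (Hd u H1 H2) as [_ D].
      assert (E' : snd (field H s (Z u)) = snd (field H s (flow s (Z a) (u - a)))).
      { destruct s; simpl; [|reflexivity]. f_equal.
        specialize (Ex (u - a)). replace (a + (u - a)) with u in Ex by ring.
        apply Ex; lra. }
      rewrite <- E'. exact D. }
  rewrite (surjective_pairing (Z (a + t))), (surjective_pairing (flow s (Z a) t)).
  f_equal; [apply Ex; lra | exact Ey].
Qed.

(** The itinerary from time [a] on, so that legs can be peeled off one at a time. *)
Definition run (s : side) (Z : R -> R * R) (a : R) : Prop :=
  exists tau : nat -> Rbar,
    tau 0%nat = Finite a /\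
    forall n, match tau n with
              | Finite c => leg H (Nat.iter n flip s) Z c (tau (S n))
              | p_infty => tau (S n) = p_infty
              | m_infty => False
              end.

Lemma run_step s Z a :
  run s Z a ->
  leg H s Z a p_infty \/ exists b : R, leg H s Z a b /\ run (flip s) Z b.
Proof.
  intros [tau [E Hl]]. pose proof (Hl 0%nat) as H0. rewrite E in H0. simpl in H0.
  destruct (tau 1%nat) as [b| |] eqn:E1.
  - right. exists b. split; [exact H0|]. exists (fun n => tau (S n)).
    split; [exact E1|]. intros n. rewrite <- Nat.iter_succ_r. apply Hl.
  - left. exact H0.
  - destruct H0 as [_ [_ []]].
Qed.

Hypothesis mu_pos : 0 < mu.

(** A trajectory that starts on [L^+] under an upward [X^-] has a leg of
    length 0, and then starts in mode [Plus] in effect: [m 0] takes this into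
    account. *)
Lemma trajectory_run Z m :
  trajectory H Z m ->
  run (m 0) Z 0 /\
  match m 0 with
  | Plus => mu <= snd (Z 0)
  | Minus => snd (Z 0) <= mu /\ (0 < b2 -> snd (Z 0) < mu)
  end.
Proof.
  intros [_ [tau [E [Hl [_ Hm]]]]].
  assert (Hrun : run (initial_side H (Z 0)) Z 0) by (exists tau; split; auto).
  pose proof (Hl 0%nat) as H0. rewrite E in H0.
  change (nth_side H (Z 0) 0) with (initial_side H (Z 0)) in H0.
  assert (Hcase : Rbar_lt 0 (tau 1%nat) \/ tau 1%nat = 0).
  { destruct (tau 1%nat) as [b| |]; simpl; auto.
    - destruct H0 as [_ [_ [Hb _]]].
      destruct Hb as [Hb|Hb]; [left; exact Hb | right; now rewrite Hb].
    - destruct H0 as [_ [_ []]]. }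
  destruct Hcase as [Hpos|Hzero].
  - assert (E0 : m 0 = nth_side H (Z 0) 0).
    { apply (Hm 0%nat (Finite 0)); [rewrite E; apply Rbar_le_refl | exact Hpos]. }
    rewrite E0.
    change (nth_side H (Z 0) 0) with (initial_side H (Z 0)). split; [exact Hrun|].
    destruct H0 as [_ [H0 _]]. specialize (H0 0 (Rle_refl 0) Hpos).
    revert H0. unfold initial_side. simpl Defs.mu.
    destruct (Rlt_dec mu (snd (Z 0))) as [Hlt|Hge]; simpl; intros H0; [lra|].
    split; [lra|]. intros Hb2. destruct (Req_dec (snd (Z 0)) mu); [tauto|lra].
  - pose proof (Hl 1%nat) as H1. rewrite Hzero in H0, H1.
    assert (Hsw : switches H (initial_side H (Z 0)) (Z 0)) by apply H0.
    assert (Hi : initial_side H (Z 0) = Minus /\ snd (Z 0) = mu).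
    { revert Hsw. unfold initial_side. simpl Defs.mu.
      destruct (Rlt_dec mu (snd (Z 0))); simpl; [lra|tauto]. }
    destruct Hi as [Hi Hy].
    assert (Hs1 : nth_side H (Z 0) 1 = Plus) by (unfold nth_side; rewrite Hi; reflexivity).
    rewrite Hs1 in H1.
    assert (H2 : Rbar_lt 0 (tau 2%nat)).
    { destruct (tau 2%nat) as [b| |]; simpl; auto.
      - destruct H1 as [_ [_ [Hb Hb']]]. destruct Hb as [Hb|Hb]; [exact Hb|].
        subst b. simpl in Hb'. lra.
      - destruct H1 as [_ [_ []]]. }
    assert (E0 : m 0 = nth_side H (Z 0) 1).
    { apply (Hm 1%nat (Finite 0)); [rewrite Hzero; apply Rbar_le_refl | exact H2]. }
    rewrite E0, Hs1.
    split; [|lra]. exists (fun n => tau (S n)). split; [exact Hzero|].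
    intros n. change Plus with (flip Minus). rewrite <- Nat.iter_succ_r, <- Hi. apply (Hl (S n)).
Qed.

Definition above_forever (Z : R -> R * R) : Prop :=
  exists T, 0 <= T /\ forall t, 0 <= t ->
    Z (T + t) = flow Plus (Z T) t /\ - mu < snd (Z (T + t)).

Lemma run_minus_forever (Z : R -> R * R) a :
  b2 <= 0 -> continuous_on (fun t => 0 <= t) Z -> 0 <= a -> run Minus Z a ->
  forall t, 0 <= t -> Z (a + t) = flow Minus (Z a) t.
Proof.
  intros Hb HZ Ha Hr t Ht. destruct (run_step _ _ _ Hr) as [Hl|[b [Hl _]]].
  - apply (leg_flow Minus Z a p_infty HZ Ha Hl t Ht I).
  - destruct Hl as [_ [_ [_ [_ Hs]]]]. simpl in Hs. lra.
Qed.

Lemma run_minus_step (Z : R -> R * R) a :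
  0 < b2 -> continuous_on (fun t => 0 <= t) Z -> 0 <= a -> run Minus Z a ->
  snd (Z a) < mu ->
  let r := (mu - snd (Z a)) / b2 in
  0 < r /\ (forall t, 0 <= t <= r -> Z (a + t) = flow Minus (Z a) t) /\
  run Plus Z (a + r).
Proof.
  intros Hb HZ Ha Hr Hy r.
  assert (Hr0 : 0 < r) by (apply Rdiv_lt_0_compat; lra).
  assert (Hrb : snd (Z a) + b2 * r = mu) by (unfold r; field; lra).
  split; [exact Hr0|].
  destruct (run_step _ _ _ Hr) as [Hl|[b [Hl Hr']]].
  - exfalso. pose proof Hl as [_ [Hns _]]. apply (Hns (a + r)); [lra|exact I|].
    rewrite (leg_flow Minus Z a p_infty HZ Ha Hl r (Rlt_le _ _ Hr0) I). simpl. split; lra.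
  - pose proof Hl as [_ [Hns [Hab [Hs _]]]]. simpl in Hs.
    assert (E := leg_flow Minus Z a b HZ Ha Hl).
    assert (Hbr : b = a + r).
    { specialize (E (b - a)). replace (a + (b - a)) with b in E by ring.
      rewrite E in Hs by (simpl; lra). simpl in Hs. nra. }
    subst b. split; [|exact Hr']. intros t Ht. apply E; simpl; lra.
Qed.

Lemma run_plus_step (Z : R -> R * R) a :
  continuous_on (fun t => 0 <= t) Z -> 0 <= a -> run Plus Z a ->
  - mu < snd (Z a) ->
  above_forever Z \/
  exists r, 0 < r /\ (forall t, 0 <= t <= r -> Z (a + t) = flow Plus (Z a) t) /\
    (forall t, 0 <= t < r -> - mu < snd (flow Plus (Z a) t)) /\
    snd (Z (a + r)) = - mu /\ run Minus Z (a + r).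
Proof.
  intros HZ Ha Hr Hy.
  assert (Habove : forall b, leg H Plus Z a b -> forall t, 0 <= t -> Rbar_lt (a + t) b ->
            - mu < snd (Z (a + t))).
  { intros b Hl t Ht Hb. destruct (continuity_clamped Z HZ) as [_ Cy].
    rewrite <- (Rmax_right 0 (a + t)) by lra.
    apply (stays_above (fun u => snd (Z (Rmax 0 u))) a (a + t) (- mu) Cy); [|lra|].
    - rewrite Rmax_right by lra. exact Hy.
    - intros s Hs. rewrite Rmax_right by lra. destruct Hl as [_ [Hns _]].
      apply (Hns s); [lra|]. eapply Rbar_le_lt_trans; [|exact Hb]. simpl. lra. }
  destruct (run_step _ _ _ Hr) as [Hl|[b [Hl Hr']]].
  - left. exists a. split; [exact Ha|]. intros t Ht. split.
    + apply (leg_flow Plus Z a p_infty HZ Ha Hl t Ht I).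
    + apply (Habove p_infty); simpl; auto.
  - right. pose proof Hl as [_ [_ [Hab Hs]]]. simpl in Hs.
    assert (E := leg_flow Plus Z a b HZ Ha Hl).
    exists (b - a). replace (a + (b - a)) with b by ring.
    assert (a <> b) by (intros ->; lra).
    split; [lra|]. split; [intros t Ht; apply E; simpl; lra|].
    split; [|split; [exact Hs | exact Hr']].
    intros t Ht. rewrite <- E by (simpl; lra). apply (Habove b); simpl; auto; lra.
Qed.

(** * Trajectories that stop switching *)

Lemma lim_of_tail (f g : R -> R) (T : R) (l : Rbar) :
  (forall t, 0 <= t -> f (T + t) = g t) -> is_lim g p_infty l -> is_lim f p_infty l.
Proof.
  intros E Hg. apply (is_lim_ext_loc (fun u => g (1 * u + - T))).
  - exists T. intros u Hu. rewrite <- E by lra. f_equal. ring.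
  - apply is_lim_comp_lin; [|lra]. simpl.
    destruct (Rle_dec 0 1) as [Hle|]; [|lra].
    destruct (Rle_lt_or_eq_dec 0 1 Hle) as [_|]; [simpl; exact Hg|lra].
Qed.

Lemma lim_affine (p a : R) :
  a <> 0 -> exists l, infinite l /\ is_lim (fun t => p + a * t) p_infty l.
Proof.
  intros Ha. destruct (Rlt_dec 0 a) as [Hp|Hn].
  - exists p_infty. split; [left; reflexivity|]. apply is_lim_spec. intros M.
    exists ((M - p) / a). intros t Ht.
    apply (Rmult_lt_compat_l a) in Ht; [|lra].
    replace (a * ((M - p) / a)) with (M - p) in Ht by (field; lra). lra.
  - exists m_infty. split; [right; reflexivity|]. apply is_lim_spec. intros M.
    exists ((M - p) / a). intros t Ht.
    apply (Rmult_lt_compat_l (- a)) in Ht; [|lra].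
    replace (- a * ((M - p) / a)) with (p - M) in Ht by (field; lra). lra.
Qed.

Lemma quadratic_large (q c d M : R) :
  0 < d -> exists K, 0 <= K /\ forall t, K < t -> M < q + c * t + d * t ^ 2.
Proof.
  intros Hd. exists (1 + (Rabs c + Rabs (M - q)) / d).
  assert (H1 := Rabs_pos c). assert (H2 := Rabs_pos (M - q)).
  assert (H3 := Rle_abs (M - q)). assert (H4 := Rle_abs (- c)). rewrite Rabs_Ropp in H4.
  assert (0 <= (Rabs c + Rabs (M - q)) / d) by (apply Rdiv_le_0_compat; lra).
  split; [lra|]. intros t Ht.
  assert (Hdt : Rabs c + Rabs (M - q) < d * t - d).
  { replace (Rabs c + Rabs (M - q)) with (d * ((Rabs c + Rabs (M - q)) / d)) by (field; lra).
    nra. }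
  nra.
Qed.

Lemma lim_quadratic (q c d : R) :
  0 < d -> is_lim (fun t => q + c * t + d * t ^ 2) p_infty p_infty.
Proof.
  intros Hd. apply is_lim_spec. intros M.
  destruct (quadratic_large q c d M Hd) as [K [_ HK]]. exists K. exact HK.
Qed.

Lemma omega_of_limits Z l1 l2 :
  is_lim (fun t => fst (Z t)) p_infty l1 -> is_lim (fun t => snd (Z t)) p_infty l2 ->
  omega_is Z (fun w => w = (l1, l2)).
Proof.
  intros H1 H2.
  assert (Hseq : forall (f : R -> R) l t, is_lim f p_infty l -> is_lim_seq t p_infty ->
            is_lim_seq (fun n => f (t n)) l).
  { intros f l t Hf Ht. apply (is_lim_comp_seq f t p_infty l Hf); auto.
    exists 0%nat. intros n _. discriminate. }
  intros [w1 w2]. split.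
  - intros [t [Ht [Hw1 Hw2]]]. simpl in *.
    f_equal.
    + rewrite <- (is_lim_seq_unique _ _ Hw1). apply is_lim_seq_unique.
      apply (Hseq (fun t => fst (Z t))); auto.
    + rewrite <- (is_lim_seq_unique _ _ Hw2). apply is_lim_seq_unique.
      apply (Hseq (fun t => snd (Z t))); auto.
  - intros E. injection E as -> ->. exists INR. split; [apply is_lim_seq_INR|]. simpl.
    split; [apply (Hseq (fun t => fst (Z t))) | apply (Hseq (fun t => snd (Z t)))];
      auto; apply is_lim_seq_INR.
Qed.

Lemma minus_forever_type Z T :
  a2 ^ 2 + b2 ^ 2 <> 0 -> (forall t, 0 <= t -> Z (T + t) = flow Minus (Z T) t) ->
  type1 Z \/ type2 Z.
Proof.
  intros Hne E.
  assert (Ex : forall l, is_lim (fun t => fst (Z T) + a2 * t) p_infty l ->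
                is_lim (fun t => fst (Z t)) p_infty l).
  { intros l. apply lim_of_tail with (T := T). intros t Ht. now rewrite E. }
  assert (Ey : forall l, is_lim (fun t => snd (Z T) + b2 * t) p_infty l ->
                is_lim (fun t => snd (Z t)) p_infty l).
  { intros l. apply lim_of_tail with (T := T). intros t Ht. now rewrite E. }
  assert (Hc : forall p c, c = 0 -> is_lim (fun t => p + c * t) p_infty p).
  { intros p c ->. apply (is_lim_ext (fun _ => p)); [intros; ring | apply is_lim_const]. }
  destruct (Req_dec a2 0) as [Ha|Ha], (Req_dec b2 0) as [Hb|Hb].
  - exfalso. apply Hne. rewrite Ha, Hb. ring.
  - destruct (lim_affine (snd (Z T)) b2 Hb) as [l [Hl L]].
    right. exists l, (fst (Z T)). split; [exact Hl|]. right.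
    apply omega_of_limits; auto.
  - destruct (lim_affine (fst (Z T)) a2 Ha) as [l [Hl L]].
    right. exists l, (snd (Z T)). split; [exact Hl|]. left.
    apply omega_of_limits; auto.
  - destruct (lim_affine (fst (Z T)) a2 Ha) as [l [Hl L]].
    destruct (lim_affine (snd (Z T)) b2 Hb) as [l' [Hl' L']].
    left. exists l, l'. split; [exact Hl|]. split; [exact Hl'|].
    apply omega_of_limits; auto.
Qed.

Lemma invisible_not_above_forever Z : a1 * b1 < 0 -> ~ above_forever Z.
Proof.
  intros Hneg [T [HT E]].
  destruct (quadratic_large (- snd (Z T)) (- (b1 * fst (Z T))) (- (a1 * b1) / 2) mu)
    as [K [HK0 HK]]; [lra|].
  specialize (HK (K + 1) ltac:(lra)). destruct (E (K + 1) ltac:(lra)) as [E1 E2].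
  rewrite E1 in E2. simpl in E2. simpl in HK. lra.
Qed.

Lemma above_forever_type Z :
  a1 ^ 2 + b1 ^ 2 <> 0 -> above_forever Z ->
  type1 Z \/ (a1 * b1 = 0 /\ type2 Z) \/ (a1 = 0 /\ comes_to_rest Z).
Proof.
  intros Hne [T [HT E]].
  assert (Ex : forall l, is_lim (fun t => fst (Z T) + a1 * t) p_infty l ->
                is_lim (fun t => fst (Z t)) p_infty l).
  { intros l. apply lim_of_tail with (T := T). intros t Ht. now rewrite (proj1 (E t Ht)). }
  assert (Ey : forall g, (forall t, snd (flow Plus (Z T) t) = g t) ->
                forall l, is_lim g p_infty l -> is_lim (fun t => snd (Z t)) p_infty l).
  { intros g Hg l. apply lim_of_tail with (T := T). intros t Ht.
    now rewrite (proj1 (E t Ht)). }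
  destruct (Req_dec a1 0) as [Ha|Ha].
  - destruct (Req_dec (fst (Z T)) 0) as [Hp|Hp].
    + right. right. split; [exact Ha|]. exists T. split; [exact HT|]. intros t Ht.
      replace t with (T + (t - T)) by ring.
      rewrite (proj1 (E (t - T) ltac:(lra))).
      rewrite (surjective_pairing (Z T)). simpl. rewrite Ha, Hp. f_equal; field.
    + right. left. split; [rewrite Ha; ring|].
      assert (Hb : b1 * fst (Z T) <> 0).
      { apply Rmult_integral_contrapositive_currified; [|exact Hp].
        intros Hb. apply Hne. rewrite Ha, Hb. ring. }
      destruct (lim_affine (snd (Z T)) (b1 * fst (Z T)) Hb) as [l [Hl L]].
      exists l, (fst (Z T)). split; [exact Hl|]. right. apply omega_of_limits.
      * apply Ex. apply (is_lim_ext (fun _ => fst (Z T))); [intros; rewrite Ha; ring|].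
        apply is_lim_const.
      * eapply Ey; [|exact L]. intros t. simpl. rewrite Ha. field.
  - destruct (lim_affine (fst (Z T)) a1 Ha) as [l [Hl L]].
    destruct (Rtotal_order (a1 * b1) 0) as [Hneg|[H0|Hpos]].
    + exfalso. apply (invisible_not_above_forever Z Hneg). now exists T.
    + right. left. split; [exact H0|].
      assert (Hb : b1 = 0) by (apply Rmult_integral in H0; tauto).
      exists l, (snd (Z T)). split; [exact Hl|]. left. apply omega_of_limits; [auto|].
      apply (Ey (fun _ => snd (Z T))); [|apply is_lim_const].
      intros t. simpl. rewrite Hb. field.
    + left. exists l, p_infty. split; [exact Hl|]. split; [left; reflexivity|].
      apply omega_of_limits; [auto|].
      eapply Ey; [|apply (lim_quadratic (snd (Z T)) (b1 * fst (Z T)) (a1 * b1 / 2)); lra].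
      intros t. simpl. field.
Qed.

(** * Touchdowns on the lower edge *)

(** Duration and horizontal displacement of a leg of [X^-] that crosses the
    whole band. *)
Definition alpha : R := 2 * mu / b2.
Definition delta : R := a2 * alpha.

Definition lap (w beta w' : R) : Prop :=
  0 < beta /\
  (forall t, 0 <= t < beta -> - mu < snd (flow Plus (w + delta, mu) t)) /\
  flow Plus (w + delta, mu) beta = (w', - mu).

(** Loops are counted from the lower edge: the [n]-th one leaves [L^-] at time
    [td n] and abscissa [w n], and [beta n] is the duration of its second half,
    from [L^+] back to [L^-]. *)
Record returns (Z : R -> R * R) (td w beta : nat -> R) : Prop := {
  returns_start : 0 <= td 0%nat;
  returns_lap : forall n, lap (w n) (beta n) (w (n + 1)%nat);
  returns_time : forall n, td (n + 1)%nat = td n + alpha + beta n;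
  returns_up : forall n t, 0 <= t <= alpha -> Z (td n + t) = flow Minus (w n, - mu) t;
  returns_down : forall n t, 0 <= t <= beta n ->
    Z (td n + alpha + t) = flow Plus (w n + delta, mu) t
}.

Definition touchdown (Z : R -> R * R) (a : R) : Prop :=
  0 <= a /\ run Minus Z a /\ snd (Z a) = - mu.

Section Upward.
Hypothesis b2_pos : 0 < b2.

Lemma alpha_pos : 0 < alpha.
Proof. apply Rdiv_lt_0_compat; lra. Qed.

Lemma flow_alpha w : flow Minus (w, - mu) alpha = (w + delta, mu).
Proof. unfold delta, alpha. simpl. f_equal. field. lra. Qed.

Lemma next_touchdown (Z : R -> R * R) a :
  continuous_on (fun t => 0 <= t) Z -> ~ above_forever Z -> touchdown Z a ->
  exists beta, touchdown Z (a + alpha + beta) /\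
    lap (fst (Z a)) beta (fst (Z (a + alpha + beta))) /\
    (forall t, 0 <= t <= alpha -> Z (a + t) = flow Minus (fst (Z a), - mu) t) /\
    (forall t, 0 <= t <= beta ->
       Z (a + alpha + t) = flow Plus (fst (Z a) + delta, mu) t).
Proof.
  intros HZ Hna [Ha [Hr Hy]]. assert (Hal := alpha_pos).
  destruct (run_minus_step Z a b2_pos HZ Ha Hr ltac:(lra)) as [_ [Eup Hr']].
  rewrite Hy in Eup, Hr'. replace ((mu - - mu) / b2) with alpha in Eup, Hr'
    by (unfold alpha; field; lra).
  assert (EZ : Z a = (fst (Z a), - mu)) by (rewrite <- Hy; apply surjective_pairing).
  rewrite EZ in Eup.
  assert (Emid : Z (a + alpha) = (fst (Z a) + delta, mu)).
  { rewrite Eup by lra. apply flow_alpha. }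
  destruct (run_plus_step Z (a + alpha) HZ ltac:(lra) Hr')
    as [Hab|[r [Hr0 [Ed [Hlow [Hend Hr'']]]]]].
  - rewrite Emid. simpl. lra.
  - contradiction.
  - exists r. rewrite Emid in Ed, Hlow.
    split; [split; [lra|split; assumption]|].
    split; [|split; assumption].
    split; [exact Hr0|]. split; [exact Hlow|].
    rewrite <- (Ed r) by lra. rewrite <- Hend. apply surjective_pairing.
Qed.

Lemma returns_from (Z : R -> R * R) a :
  continuous_on (fun t => 0 <= t) Z -> ~ above_forever Z -> touchdown Z a ->
  exists td w beta, returns Z td w beta /\ td 0%nat = a.
Proof.
  intros HZ Hna Ha.
  pose (N := fun (x : {a | touchdown Z a}) =>
    constructive_indefinite_description _
      (next_touchdown Z (proj1_sig x) HZ Hna (proj2_sig x))).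
  pose (next := fun x => exist (touchdown Z)
    (proj1_sig x + alpha + proj1_sig (N x)) (proj1 (proj2_sig (N x)))).
  pose (s := fun n => Nat.iter n next (exist _ a Ha)).
  exists (fun n => proj1_sig (s n)), (fun n => fst (Z (proj1_sig (s n)))),
    (fun n => proj1_sig (N (s n))).
  split; [|reflexivity].
  assert (E : forall n, s (n + 1)%nat = next (s n)).
  { intros n. rewrite Nat.add_1_r. reflexivity. }
  constructor.
  - apply Ha.
  - intros n. rewrite E. apply (proj2_sig (N (s n))).
  - intros n. rewrite E. reflexivity.
  - intros n. apply (proj2_sig (N (s n))).
  - intros n. apply (proj2_sig (N (s n))).
Qed.

(** Stability concerns trajectories that start anywhere near the cycle, hence
    the phase before the first touchdown is needed explicitly: [r] is the time
    spent with [X^-] and [beta] the time spent with [X^+]. *)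
Lemma first_touchdown (Z : R -> R * R) m :
  trajectory H Z m -> ~ above_forever Z ->
  exists r beta, 0 <= r /\ 0 < beta /\ touchdown Z (r + beta) /\
    match m 0 with
    | Plus => r = 0 /\ mu <= snd (Z 0)
    | Minus => r = (mu - snd (Z 0)) / b2 /\ snd (Z 0) < mu
    end /\
    (forall t, 0 <= t <= r -> Z t = flow Minus (Z 0) t) /\
    (forall t, 0 <= t <= beta -> Z (r + t) = flow Plus (Z r) t) /\
    (forall t, 0 <= t < beta -> - mu < snd (flow Plus (Z r) t)).
Proof.
  intros Ht Hna. pose proof (proj1 Ht) as HZ.
  destruct (trajectory_run Z m Ht) as [Hr Hy].
  assert (Hplus : forall r, 0 <= r -> run Plus Z r -> mu <= snd (Z r) ->
    exists beta, 0 < beta /\ touchdown Z (r + beta) /\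
      (forall t, 0 <= t <= beta -> Z (r + t) = flow Plus (Z r) t) /\
      (forall t, 0 <= t < beta -> - mu < snd (flow Plus (Z r) t))).
  { intros r Hr0 Hrr Hrm.
    destruct (run_plus_step Z r HZ Hr0 Hrr ltac:(lra)) as [Hab|[b [Hb [Ed [Hlow [Hend Hr'']]]]]];
      [contradiction|].
    exists b. split; [exact Hb|]. split; [split; [lra|split; assumption]|]. split; assumption. }
  destruct (m 0).
  - destruct (Hplus 0 (Rle_refl 0) Hr Hy) as [b [Hb [Htd [Ed Hlow]]]].
    exists 0, b. split; [lra|]. split; [exact Hb|]. split; [exact Htd|].
    split; [split; [reflexivity|exact Hy]|]. split; [|split; assumption].
    intros t Ht0. replace t with 0 by lra. now rewrite flow_0.
  - destruct Hy as [_ Hy]. specialize (Hy b2_pos).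
    destruct (run_minus_step Z 0 b2_pos HZ (Rle_refl 0) Hr Hy) as [Hr0 [Eup Hr']].
    set (r := (mu - snd (Z 0)) / b2) in *. rewrite Rplus_0_l in Hr'.
    assert (Hend : snd (Z r) = mu).
    { rewrite <- (Rplus_0_l r), Eup by lra. simpl. unfold r. field. lra. }
    destruct (Hplus r ltac:(lra) Hr' ltac:(lra)) as [b [Hb [Htd [Ed Hlow]]]].
    exists r, b. split; [lra|]. split; [exact Hb|]. split; [exact Htd|].
    split; [split; [reflexivity|exact Hy]|]. split; [|split; assumption].
    intros t Ht0. rewrite <- Eup by lra. f_equal. ring.
Qed.

(** Without a final stay in [X^+], each touchdown is followed by another one. *)
Lemma trajectory_dichotomy (Z : R -> R * R) m :
  trajectory H Z m -> above_forever Z \/ exists td w beta, returns Z td w beta.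
Proof.
  intros Ht. destruct (classic (above_forever Z)) as [|Hna]; [now left|]. right.
  destruct (first_touchdown Z m Ht Hna) as [r [b [_ [_ [Htd _]]]]].
  destruct (returns_from Z (r + b) (proj1 Ht) Hna Htd) as [td [w [beta [Hret _]]]].
  exists td, w, beta. exact Hret.
Qed.

Section Returns.
Variables (Z : R -> R * R) (td w beta : nat -> R).
Hypothesis HR : returns Z td w beta.

Lemma beta_pos n : 0 < beta n.
Proof. apply (returns_lap _ _ _ _ HR n). Qed.

Lemma landing n : flow Plus (w n + delta, mu) (beta n) = (w (n + 1)%nat, - mu).
Proof. apply (returns_lap _ _ _ _ HR n). Qed.

Lemma returns_lower n k : td n + INR k * alpha <= td (n + k)%nat.
Proof.
  induction k as [|k IH].
  - rewrite Nat.add_0_r. simpl. lra.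
  - replace (n + S k)%nat with (n + k + 1)%nat by lia.
    rewrite (returns_time _ _ _ _ HR), S_INR. assert (Hb := beta_pos (n + k)%nat). lra.
Qed.

Lemma returns_le n k : (n <= k)%nat -> td n <= td k.
Proof.
  intros Hnk. replace k with (n + (k - n))%nat by lia.
  assert (Hl := returns_lower n (k - n)%nat). assert (Ha := alpha_pos).
  assert (Hi := pos_INR (k - n)). nra.
Qed.

Lemma returns_nonneg n : 0 <= td n.
Proof.
  assert (H0 := returns_start _ _ _ _ HR). assert (H1 := returns_le 0 n ltac:(lia)). lra.
Qed.

Lemma returns_unbounded T : exists n, T < td n.
Proof.
  assert (Ha := alpha_pos). destruct (nfloor_ex (Rabs T / alpha)) as [n [_ Hn]].
  { apply Rdiv_le_0_compat; [apply Rabs_pos|lra]. }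
  exists (n + 1)%nat. assert (Hl := returns_lower 0 (n + 1)). assert (H0 := returns_nonneg 0).
  rewrite plus_INR in Hl. simpl in Hl. simpl (0 + _)%nat in Hl.
  assert (HT := Rle_abs T).
  apply (Rmult_lt_compat_r alpha) in Hn; [|lra].
  replace (Rabs T / alpha * alpha) with (Rabs T) in Hn by (field; lra). simpl in Hn. lra.
Qed.

Lemma returns_to_infinity : is_lim_seq td p_infty.
Proof.
  apply is_lim_seq_spec. intros T. destruct (returns_unbounded T) as [n Hn].
  exists n. intros k Hk. assert (Hl := returns_le n k Hk). lra.
Qed.

Lemma returns_cover N t :
  td N <= t -> exists n, (N <= n)%nat /\
    ((exists s, 0 <= s < alpha /\ t = td n + s) \/
     (exists s, 0 <= s < beta n /\ t = td n + alpha + s)).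
Proof.
  intros Ht. destruct (returns_unbounded t) as [K HK].
  assert (HNK : (N <= K)%nat).
  { destruct (le_lt_dec N K) as [|Hlt]; [assumption|].
    assert (Hl := returns_le K N ltac:(lia)). lra. }
  assert (Hex : forall j, t < td (N + j)%nat ->
            exists n, (N <= n)%nat /\ td n <= t < td (n + 1)%nat).
  { induction j as [|j IH]; intros Hj.
    - rewrite Nat.add_0_r in Hj. lra.
    - destruct (Rlt_le_dec t (td (N + j)%nat)) as [Hlt|Hle]; [auto|].
      exists (N + j)%nat. split; [lia|]. split; [exact Hle|].
      replace (N + j + 1)%nat with (N + S j)%nat by lia. exact Hj. }
  destruct (Hex (K - N)%nat) as [n [Hn [H1 H2]]].
  { now replace (N + (K - N))%nat with K by lia. }
  exists n. split; [exact Hn|]. rewrite (returns_time _ _ _ _ HR) in H2.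
  destruct (Rlt_le_dec t (td n + alpha)) as [Hlt|Hle].
  - left. exists (t - td n). split; [lra|ring].
  - right. exists (t - td n - alpha). split; [lra|ring].
Qed.
End Returns.

End Upward.

(** * Construction of trajectories *)

Section Gluing.
Variables (start : nat -> R * R) (dur T : nat -> R).
Let side_at k := Nat.iter k flip Minus.
Hypothesis dur_pos : forall k, 0 < dur k.
Hypothesis T_0 : T 0%nat = 0.
Hypothesis T_succ : forall k, T (S k) = T k + dur k.
Hypothesis T_unbounded : forall t, exists k, t < T k.
Hypothesis start_succ : forall k, flow (side_at k) (start k) (dur k) = start (S k).

Lemma T_lt j k : (j < k)%nat -> T j < T k.
Proof.
  induction 1 as [|k _ IH]; rewrite T_succ.
  - assert (P := dur_pos j). lra.
  - assert (P := dur_pos k). lra.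
Qed.

Lemma T_locate t : 0 <= t -> exists k, T k <= t < T (S k).
Proof.
  intros Ht. destruct (T_unbounded t) as [K HK]. induction K as [|K IH]; [lra|].
  destruct (Rlt_le_dec t (T K)) as [Hlt|Hle]; [auto|]. exists K. lra.
Qed.

(** Two consecutive arcs agree at their common time, hence the value at [t] does
    not depend on the arc that contains [t]. *)
Lemma glue_curve :
  exists Z : R -> R * R, forall k t, T k <= t <= T (S k) ->
    Z t = flow (side_at k) (start k) (t - T k).
Proof.
  assert (Hex : forall t, exists z, forall k, T k <= t <= T (S k) ->
            z = flow (side_at k) (start k) (t - T k)).
  { intros t. destruct (Rlt_le_dec t 0) as [Hneg|Hpos].
    - exists (0, 0). intros k Hk. exfalso.
      destruct k as [|k]; [lra|]. assert (P := T_lt 0 (S k) ltac:(lia)). lra.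
    - destruct (T_locate t Hpos) as [k Hk].
      exists (flow (side_at k) (start k) (t - T k)). intros j Hj.
      destruct (lt_eq_lt_dec j k) as [[Hlt|Heq]|Hgt].
      + assert (Hjk : k = S j).
        { destruct (le_lt_dec k (S j)) as [|Hl]; [lia|].
          assert (P := T_lt (S j) k Hl). lra. }
        subst k. assert (Et : t = T (S j)) by lra. subst t.
        rewrite Rminus_diag, flow_0, <- start_succ. f_equal. rewrite T_succ. ring.
      + now subst.
      + destruct (le_lt_dec j (S k)) as [Hl|Hl].
        * assert (j = S k) by lia. subst j. lra.
        * assert (P := T_lt (S k) j Hl). lra. }
  exists (fun t => proj1_sig (constructive_indefinite_description _ (Hex t))).
  intros k t. apply (proj2_sig (constructive_indefinite_description _ (Hex t))).
Qed.

Lemma glue_sides :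
  exists m : R -> side, forall k t, T k <= t < T (S k) -> m t = side_at k.
Proof.
  assert (Hex : forall t, exists s, forall k, T k <= t < T (S k) -> s = side_at k).
  { intros t. destruct (classic (exists k, T k <= t < T (S k))) as [[k Hk]|Hno].
    - exists (side_at k). intros j Hj. f_equal.
      destruct (lt_eq_lt_dec j k) as [[Hlt|Heq]|Hgt]; [|now auto|]; exfalso.
      + destruct (le_lt_dec k (S j)) as [Hl|Hl].
        * assert (k = S j) by lia. subst k. lra.
        * assert (P := T_lt (S j) k Hl). lra.
      + destruct (le_lt_dec j (S k)) as [Hl|Hl].
        * assert (j = S k) by lia. subst j. lra.
        * assert (P := T_lt (S k) j Hl). lra.
    - exists Minus. intros k Hk. exfalso. eauto. }
  exists (fun t => proj1_sig (constructive_indefinite_description _ (Hex t))).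
  intros k t. apply (proj2_sig (constructive_indefinite_description _ (Hex t))).
Qed.

Lemma flow_continuous s p t eps :
  0 < eps -> exists d, 0 < d /\
    forall u, Rabs (u - t) < d -> ball (flow s p t) eps (flow s p u).
Proof.
  intros Heps. destruct (flow_derive s p t) as [Dx Dy].
  assert (Cx := ex_derive_continuous (fun u => fst (flow s p u)) t (ex_intro _ _ Dx)).
  assert (Cy := ex_derive_continuous (fun u => snd (flow s p u)) t (ex_intro _ _ Dy)).
  destruct (proj1 (filterlim_locally _ _) Cx (mkposreal eps Heps)) as [dx Hx].
  destruct (proj1 (filterlim_locally _ _) Cy (mkposreal eps Heps)) as [dy Hy].
  exists (Rmin dx dy). split; [apply Rmin_glb_lt; apply cond_pos|].
  intros u Hu. apply ball_RR. split.
  - apply Hx. change (Rabs (u - t) < dx). eapply Rlt_le_trans; [exact Hu|apply Rmin_l].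
  - apply Hy. change (Rabs (u - t) < dy). eapply Rlt_le_trans; [exact Hu|apply Rmin_r].
Qed.

(** At the junction times, continuity holds on each side by the arc of that
    side. *)
Lemma glue_continuous (Z : R -> R * R) :
  (forall k t, T k <= t <= T (S k) -> Z t = flow (side_at k) (start k) (t - T k)) ->
  continuous_on (fun t => 0 <= t) Z.
Proof.
  intros HZ t Ht. apply filterlim_locally. intros eps.
  destruct (T_locate t Ht) as [k Hk].
  assert (Hright : exists d, 0 < d /\ forall u, Rabs (u - t) < d -> t <= u ->
            ball (Z t) eps (Z u)).
  { destruct (flow_continuous (side_at k) (start k) (t - T k) eps (cond_pos eps))
      as [d [Hd Hb]].
    exists (Rmin d (T (S k) - t)). split; [apply Rmin_glb_lt; lra|].
    intros u Hu Htu.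
    assert (H1 := Rmin_l d (T (S k) - t)). assert (H2 := Rmin_r d (T (S k) - t)).
    assert (Hu' := Rabs_def2 _ _ Hu).
    rewrite (HZ k t), (HZ k u) by lra. apply Hb.
    replace (u - T k - (t - T k)) with (u - t) by ring. lra. }
  assert (Hleft : exists d, 0 < d /\ forall u, Rabs (u - t) < d -> 0 <= u <= t ->
            ball (Z t) eps (Z u)).
  { assert (Hj : t = 0 \/ exists j, T j < t <= T (S j)).
    { destruct (Req_dec t (T k)) as [E|E].
      - destruct k as [|k]; [left; lra|]. right. exists k.
        assert (P := T_lt k (S k) ltac:(lia)). lra.
      - right. exists k. lra. }
    destruct Hj as [->|[j Hj]].
    - exists 1. split; [lra|]. intros u _ Hu. replace u with 0 by lra. apply ball_center.
    - destruct (flow_continuous (side_at j) (start j) (t - T j) eps (cond_pos eps))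
        as [d [Hd Hb]].
      exists (Rmin d (t - T j)). split; [apply Rmin_glb_lt; lra|].
      intros u Hu Htu.
      assert (H1 := Rmin_l d (t - T j)). assert (H2 := Rmin_r d (t - T j)).
      assert (Hu' := Rabs_def2 _ _ Hu).
      rewrite (HZ j t), (HZ j u) by lra. apply Hb.
      replace (u - T j - (t - T j)) with (u - t) by ring. lra. }
  destruct Hright as [d [Hd Hr]], Hleft as [d' [Hd' Hl]].
  exists (mkposreal _ (Rmin_glb_lt _ _ _ Hd Hd')). intros u Hu Hu0.
  change (Rabs (u - t) < Rmin d d') in Hu.
  destruct (Rle_lt_dec t u) as [Htu|Htu].
  - apply Hr; [|exact Htu]. eapply Rlt_le_trans; [exact Hu|apply Rmin_l].
  - apply Hl; [|lra]. eapply Rlt_le_trans; [exact Hu|apply Rmin_r].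
Qed.

Lemma glue_trajectory :
  initial_side H (start 0%nat) = Minus ->
  (forall k t, 0 <= t < dur k -> ~ switches H (side_at k) (flow (side_at k) (start k) t)) ->
  (forall k, switches H (side_at k) (start (S k))) ->
  exists Z m, trajectory H Z m /\
    (forall k t, 0 <= t <= dur k -> Z (T k + t) = flow (side_at k) (start k) t) /\
    (forall k t, 0 <= t < dur k -> m (T k + t) = side_at k).
Proof.
  intros Hinit Hns Hsw.
  destruct glue_curve as [Z HZ]. destruct glue_sides as [m Hm].
  assert (HZ' : forall k t, 0 <= t <= dur k -> Z (T k + t) = flow (side_at k) (start k) t).
  { intros k t Ht. rewrite (HZ k) by (rewrite T_succ; lra). f_equal. ring. }
  assert (HZ0 : Z 0 = start 0%nat).
  { rewrite <- T_0, <- (Rplus_0_r (T 0%nat)), HZ', flow_0; [reflexivity|].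
    assert (P := dur_pos 0). lra. }
  assert (Hside : forall k, nth_side H (Z 0) k = side_at k).
  { intros k. unfold nth_side. rewrite HZ0, Hinit. reflexivity. }
  exists Z, m. split; [|split; [exact HZ'|]].
  2: { intros k t Ht. apply Hm. rewrite T_succ. lra. }
  split; [apply glue_continuous; exact HZ|].
  exists (fun k => Finite (T k)).
  split; [now rewrite T_0|]. split; [|split].
  - intros k. rewrite Hside. split; [|split].
    + intros t H1 H2. simpl in H2.
      assert (Hloc : locally t (fun u => flow (side_at k) (start k) (u - T k) = Z u)).
      { assert (Hd : 0 < Rmin (t - T k) (T (S k) - t)) by (apply Rmin_glb_lt; lra).
        exists (mkposreal _ Hd). intros u Hu.
        change (Rabs (u - t) < Rmin (t - T k) (T (S k) - t)) in Hu.
        assert (H3 := Rmin_l (t - T k) (T (S k) - t)).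
        assert (H4 := Rmin_r (t - T k) (T (S k) - t)).
        apply Rabs_def2 in Hu. symmetry. apply HZ. lra. }
      rewrite (HZ k t) by lra.
      assert (Hshift : forall (f : R -> R) l, is_derive f (t - T k) l ->
                is_derive (fun u => f (u - T k)) t l).
      { intros f l Hf. replace l with (scal 1 l) by (unfold scal; simpl; unfold mult; simpl; ring).
        apply (is_derive_comp f (fun u => u - T k)); [exact Hf|].
        auto_derive; auto. }
      destruct (flow_derive (side_at k) (start k) (t - T k)) as [Dx Dy].
      split.
      * apply (is_derive_ext_loc (fun u => fst (flow (side_at k) (start k) (u - T k)))).
        -- apply (filter_imp _ _ (fun u E => f_equal fst E) Hloc).
        -- apply (Hshift (fun u => fst (flow (side_at k) (start k) u))). exact Dx.
      * apply (is_derive_ext_loc (fun u => snd (flow (side_at k) (start k) (u - T k)))).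
        -- apply (filter_imp _ _ (fun u E => f_equal snd E) Hloc).
        -- apply (Hshift (fun u => snd (flow (side_at k) (start k) u))). exact Dy.
    + intros t H1 H2. simpl in H2. rewrite (HZ k) by lra. apply Hns. rewrite T_succ in H2. lra.
    + assert (Hd := dur_pos k). rewrite (HZ k) by (rewrite T_succ; lra).
      rewrite T_succ. split; [lra|].
      replace (T k + dur k - T k) with (dur k) by ring. rewrite start_succ. apply Hsw.
  - intros t Ht. destruct (T_locate t Ht) as [k Hk]. exists k. simpl. lra.
  - intros k t H1 H2. rewrite Hside. destruct t as [t| |]; simpl in H1, H2; try tauto.
    apply Hm. simpl. lra.
Qed.
End Gluing.

Lemma iter_flip_even n : Nat.iter (2 * n) flip Minus = Minus.
Proof.
  induction n as [|n IH]; [reflexivity|].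
  replace (2 * S n)%nat with (S (S (2 * n))) by lia.
  change (flip (flip (Nat.iter (2 * n) flip Minus)) = Minus). now rewrite IH.
Qed.

Lemma iter_flip_odd n : Nat.iter (2 * n + 1) flip Minus = Plus.
Proof.
  rewrite Nat.add_1_r. change (flip (Nat.iter (2 * n) flip Minus) = Plus).
  now rewrite iter_flip_even.
Qed.

Lemma parity k : exists n, k = (2 * n)%nat \/ k = (2 * n + 1)%nat.
Proof.
  destruct (Nat.Even_or_Odd k) as [[n Hn]|[n Hn]]; exists n; auto.
Qed.

(** A sequence of consistent laps is realised by a trajectory.  This provides the
    cycles, from constant sequences, and the trajectory that escapes from an
    unstable cycle. *)
Lemma laps_trajectory (w beta : nat -> R) :
  0 < b2 -> (forall n, lap (w n) (beta n) (w (n + 1)%nat)) ->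
  exists Z m td, trajectory H Z m /\ returns Z td w beta /\ td 0%nat = 0 /\
    (forall n t, 0 <= t < alpha -> m (td n + t) = Minus) /\
    (forall n t, 0 <= t < beta n -> m (td n + alpha + t) = Plus).
Proof.
  intros Hb Hlap. assert (Ha := alpha_pos Hb).
  pose (start := fun k => if Nat.even k then (w (Nat.div2 k), - mu)
                          else (w (Nat.div2 k) + delta, mu)).
  pose (dur := fun k => if Nat.even k then alpha else beta (Nat.div2 k)).
  pose (T := fix T k := match k with O => 0 | S k => T k + dur k end).
  assert (Heven : forall n, Nat.even (2 * n) = true /\ Nat.div2 (2 * n) = n).
  { intros n. split; [apply Nat.even_even | apply Nat.div2_double]. }
  assert (Hodd : forall n, Nat.even (2 * n + 1) = false /\ Nat.div2 (2 * n + 1) = n).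
  { intros n. split; [apply Nat.even_odd |].
    rewrite Nat.add_1_r. apply Nat.div2_succ_double. }
  assert (Se : forall n, start (2 * n)%nat = (w n, - mu)).
  { intros n. unfold start. destruct (Heven n) as [-> ->]. reflexivity. }
  assert (So : forall n, start (2 * n + 1)%nat = (w n + delta, mu)).
  { intros n. unfold start. destruct (Hodd n) as [-> ->]. reflexivity. }
  assert (De : forall n, dur (2 * n)%nat = alpha).
  { intros n. unfold dur. now rewrite (proj1 (Heven n)). }
  assert (Do : forall n, dur (2 * n + 1)%nat = beta n).
  { intros n. unfold dur. destruct (Hodd n) as [-> ->]. reflexivity. }
  assert (Te : forall n, T (2 * n + 1)%nat = T (2 * n)%nat + alpha).
  { intros n. rewrite Nat.add_1_r. simpl T. now rewrite <- (De n). }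
  assert (To : forall n, T (2 * (n + 1))%nat = T (2 * n)%nat + alpha + beta n).
  { intros n. replace (2 * (n + 1))%nat with (S (2 * n + 1)) by lia.
    change (T (2 * n + 1)%nat + dur (2 * n + 1)%nat = T (2 * n)%nat + alpha + beta n).
    now rewrite Te, Do. }
  assert (Hmul : forall n, INR n * alpha <= T (2 * n)%nat).
  { induction n as [|n IH]; [simpl; lra|]. rewrite <- Nat.add_1_r, To, plus_INR. simpl INR.
    assert (H := proj1 (Hlap n)). lra. }
  destruct (glue_trajectory start dur T) as [Z [m [Ht [HZ Hm]]]].
  - intros k. destruct (parity k) as [n [->| ->]]; rewrite ?De, ?Do; [exact Ha|apply Hlap].
  - reflexivity.
  - reflexivity.
  - intros t. destruct (nfloor_ex (Rabs t / alpha)) as [n [_ Hn]].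
    { apply Rdiv_le_0_compat; [apply Rabs_pos|lra]. }
    exists (2 * (n + 1))%nat. assert (Hl := Hmul (n + 1)%nat). rewrite plus_INR in Hl.
    simpl in Hl, Hn. assert (HT := Rle_abs t).
    apply (Rmult_lt_compat_r alpha) in Hn; [|lra].
    replace (Rabs t / alpha * alpha) with (Rabs t) in Hn by (field; lra).
    eapply Rlt_le_trans; [|exact Hl]. lra.
  - intros k. destruct (parity k) as [n [->| ->]].
    + rewrite iter_flip_even, Se, De, flow_alpha by exact Hb.
      rewrite <- Nat.add_1_r. now rewrite So.
    + rewrite iter_flip_odd, So, Do.
      replace (S (2 * n + 1)) with (2 * (n + 1))%nat by lia. rewrite Se. apply Hlap.
  - unfold initial_side. simpl. destruct (Rlt_dec mu (- mu)); [lra|reflexivity].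
  - intros k t. destruct (parity k) as [n [->| ->]].
    + rewrite iter_flip_even, Se, De. intros Hk [Hsw _]. simpl in Hsw.
      assert (Hend := f_equal snd (flow_alpha Hb (w n))). simpl in Hend. nra.
    + rewrite iter_flip_odd, So, Do. intros Hk Hsw. simpl in Hsw.
      assert (Hl := proj1 (proj2 (Hlap n)) t Hk). simpl in Hl. lra.
  - intros k. destruct (parity k) as [n [->| ->]].
    + rewrite iter_flip_even, <- Nat.add_1_r, So. simpl. lra.
    + rewrite iter_flip_odd. replace (S (2 * n + 1)) with (2 * (n + 1))%nat by lia.
      rewrite Se. reflexivity.
  - exists Z, m, (fun n => T (2 * n)%nat). split; [exact Ht|]. split; [constructor|split; [|split]].
    + simpl. lra.
    + exact Hlap.
    + exact To.
    + intros n t. specialize (HZ (2 * n)%nat t). rewrite iter_flip_even, Se, De in HZ. exact HZ.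
    + intros n t. specialize (HZ (2 * n + 1)%nat t). rewrite iter_flip_odd, So, Do, Te in HZ.
      exact HZ.
    + reflexivity.
    + intros n t. specialize (Hm (2 * n)%nat t). rewrite iter_flip_even, De in Hm. exact Hm.
    + intros n t. specialize (Hm (2 * n + 1)%nat t). rewrite iter_flip_odd, Do, Te in Hm.
      exact Hm.
Qed.

(** * Periodic orbits, isolation and convergence *)

Lemma periodic_reduce (Z : R -> R * R) T :
  0 < T -> (forall t, 0 <= t -> Z (t + T) = Z t) ->
  forall t, 0 <= t -> exists t', 0 <= t' <= T /\ Z t' = Z t.
Proof.
  intros HT Hper t Ht. destruct (nfloor_ex (t / T)) as [n [Hn1 Hn2]].
  { apply Rdiv_le_0_compat; lra. }
  assert (Hb : t <= INR (n + 1) * T).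
  { apply (Rmult_lt_compat_r T) in Hn2; [|lra].
    replace (t / T * T) with t in Hn2 by (field; lra). rewrite plus_INR. simpl. lra. }
  clear Hn1 Hn2. revert t Ht Hb. induction (n + 1)%nat as [|k IH]; intros t Ht Hb.
  - simpl in Hb. exists t. split; [lra|reflexivity].
  - destruct (Rle_dec t T) as [|Hgt]; [exists t; split; [lra|reflexivity]|].
    rewrite S_INR in Hb. destruct (IH (t - T)) as [t' [Ht' E]]; [lra|lra|].
    exists t'. split; [exact Ht'|]. rewrite E, <- Hper by lra. f_equal. ring.
Qed.

(** A periodic orbit is the continuous image of a compact interval. *)
Lemma periodic_orbit_closed (Z : R -> R * R) m p :
  periodic_trajectory H Z m -> (forall eps, 0 < eps -> near_orbit Z eps p) -> orbit Z p.
Proof.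
  intros [Ht [[T [HT Hper]] _]] Hnear.
  destruct (continuity_clamped Z (proj1 Ht)) as [Cx Cy].
  pose (f := fun t => Rabs (fst (Z (Rmax 0 t)) - fst p) + Rabs (snd (Z (Rmax 0 t)) - snd p)).
  destruct (continuity_ab_min f 0 T) as [t0 [Hmin Ht0]]; [lra| |].
  { intros t _. apply continuity_pt_plus.
    - apply (continuity_pt_comp (fun t => fst (Z (Rmax 0 t)) - fst p) Rabs).
      + apply continuity_pt_minus; [apply Cx|]. apply continuity_pt_const. easy.
      + apply Rcontinuity_abs.
    - apply (continuity_pt_comp (fun t => snd (Z (Rmax 0 t)) - snd p) Rabs).
      + apply continuity_pt_minus; [apply Cy|]. apply continuity_pt_const. easy.
      + apply Rcontinuity_abs. }
  assert (Hf0 : 0 <= f t0).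
  { unfold f. apply Rplus_le_le_0_compat; apply Rabs_pos. }
  destruct Hf0 as [Hpos|Hzero].
  - exfalso. destruct (Hnear (f t0 / 2)) as [q [[t [Htp Eq]] Hb]]; [lra|].
    destruct (periodic_reduce Z T HT Hper t Htp) as [t' [Ht' E]].
    specialize (Hmin t' Ht'). apply (proj1 (ball_RR _ _ _)) in Hb. rewrite <- Eq, <- E in Hb.
    unfold f at 2 in Hmin. rewrite Rmax_right in Hmin by lra.
    rewrite (Rabs_minus_sym (fst (Z t'))), (Rabs_minus_sym (snd (Z t'))) in Hmin. lra.
  - exists t0. split; [lra|]. unfold f in Hzero. rewrite Rmax_right in Hzero by lra.
    assert (H1 := Rabs_pos (fst (Z t0) - fst p)). assert (H2 := Rabs_pos (snd (Z t0) - snd p)).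
    rewrite (surjective_pairing (Z t0)), (surjective_pairing p).
    f_equal; apply Rminus_diag_uniq; apply Rabs_eq_0; lra.
Qed.

Lemma periodic_shift (Z : R -> R * R) T :
  0 < T -> (forall t, 0 <= t -> Z (t + T) = Z t) ->
  forall n t, 0 <= t -> Z (t + INR n * T) = Z t.
Proof.
  intros HT Hper. induction n as [|n IH]; intros t Ht.
  - simpl. f_equal. ring.
  - rewrite S_INR. assert (Hn := pos_INR n).
    replace (t + (INR n + 1) * T) with ((t + INR n * T) + T) by ring.
    rewrite Hper by nra. apply IH, Ht.
Qed.

Lemma is_lim_seq_affine a T : 0 < T -> is_lim_seq (fun n => a + INR n * T) p_infty.
Proof.
  intros HT. apply is_lim_seq_spec. intros M.
  destruct (nfloor_ex (Rabs (M - a) / T)) as [N [_ HN]].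
  { apply Rdiv_le_0_compat; [apply Rabs_pos|lra]. }
  exists (N + 1)%nat. intros n Hn. apply le_INR in Hn. rewrite plus_INR in Hn. simpl in Hn.
  apply (Rmult_lt_compat_r T) in HN; [|lra].
  replace (Rabs (M - a) / T * T) with (Rabs (M - a)) in HN by (field; lra).
  assert (Ha := Rle_abs (M - a)). nra.
Qed.

(** The times [t + n T] all give the same point. *)
Lemma periodic_recurrent (Z : R -> R * R) m p :
  periodic_trajectory H Z m -> orbit Z p -> omega_limit Z (to_Rbar2 p).
Proof.
  intros [_ [[T [HT Hper]] _]] [t [Ht E]].
  exists (fun n => t + INR n * T). split; [now apply is_lim_seq_affine|].
  split; simpl.
  - apply (is_lim_seq_ext (fun _ => fst p)); [|apply is_lim_seq_const].
    intros n. now rewrite (periodic_shift Z T HT Hper n t Ht), E.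
  - apply (is_lim_seq_ext (fun _ => snd p)); [|apply is_lim_seq_const].
    intros n. now rewrite (periodic_shift Z T HT Hper n t Ht), E.
Qed.

Lemma periodic_no_escape (Z : R -> R * R) m l :
  periodic_trajectory H Z m -> infinite l ->
  ~ is_lim (fun t => fst (Z t)) p_infty l /\ ~ is_lim (fun t => snd (Z t)) p_infty l.
Proof.
  intros [_ [[T [HT Hper]] _]] Hl.
  assert (Key : forall g : R * R -> R, ~ is_lim (fun t => g (Z t)) p_infty l).
  { intros g Hg.
    assert (Hs : is_lim_seq (fun n => g (Z (0 + INR n * T))) l).
    { apply (is_lim_comp_seq (fun t => g (Z t)) _ p_infty l Hg).
      - exists 0%nat. intros n _. discriminate.
      - now apply is_lim_seq_affine. }
    apply (is_lim_seq_ext _ (fun _ => g (Z 0))) in Hs.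
    - apply is_lim_seq_unique in Hs. rewrite Lim_seq_const in Hs.
      destruct Hl as [-> | ->]; discriminate.
    - intros n. now rewrite (periodic_shift Z T HT Hper n 0 (Rle_refl 0)). }
  split; [apply (Key fst) | apply (Key snd)].
Qed.

Lemma omega_limit_near (Z : R -> R * R) p eps :
  0 < eps -> omega_limit Z (to_Rbar2 p) -> near_orbit Z eps p.
Proof.
  intros Heps [t [Ht [Hx Hy]]]. simpl in Hx, Hy.
  apply is_lim_seq_spec in Ht, Hx, Hy.
  destruct (Ht 0) as [N1 H1].
  destruct (Hx (mkposreal _ Heps)) as [N2 H2]. destruct (Hy (mkposreal _ Heps)) as [N3 H3].
  pose (n := (N1 + N2 + N3)%nat).
  exists (Z (t n)). split.
  - exists (t n). split; [|reflexivity]. apply Rlt_le, H1. unfold n. lia.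
  - apply ball_RR. rewrite Rabs_minus_sym, (Rabs_minus_sym (snd p)).
    split; [apply H2|apply H3]; unfold n; lia.
Qed.

(** A periodic orbit is recurrent and closed, hence equal to its own limit set;
    so all the periodic orbits with limit set [orbit Zc] coincide with it. *)
Lemma isolated_of_attraction Zc :
  (forall Z m, periodic_trajectory H Z m -> omega_is Z (orbit_in_Rbar2 Zc)) ->
  isolated H Zc.
Proof.
  intros Hom. exists 1. split; [lra|]. intros Z m HZ _ p.
  specialize (Hom Z m HZ). split; intros Hp.
  - destruct (proj1 (Hom _) (periodic_recurrent Z m p HZ Hp)) as [q [Hq E]].
    injection E as E1 E2. replace p with q; [exact Hq|].
    rewrite (surjective_pairing p), (surjective_pairing q). congruence.
  - apply (periodic_orbit_closed Z m p HZ). intros eps Heps.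
    apply omega_limit_near; [exact Heps|]. apply Hom. exists p. auto.
Qed.

(** The flows are polynomial, hence Lipschitz in the initial point and the time
    together, on bounded sets. *)
Lemma flow_close M :
  0 <= M -> exists C, 1 <= C /\ forall s p q t t' eta,
    Rabs (fst p) <= M -> 0 <= t <= M -> eta <= 1 ->
    Rabs (fst q - fst p) <= eta -> Rabs (snd q - snd p) <= eta -> Rabs (t' - t) <= eta ->
    Rabs (fst (flow s q t') - fst (flow s p t)) <= C * eta /\
    Rabs (snd (flow s q t') - snd (flow s p t)) <= C * eta.
Proof.
  intros HM. exists (1 + Rabs a1 + Rabs a2 + Rabs b2 + Rabs b1 * (2 * M + 1)
                     + Rabs (a1 * b1) * (2 * M + 1)).
  assert (H1 := Rabs_pos a1). assert (H2 := Rabs_pos a2). assert (H3 := Rabs_pos b2).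
  assert (H4 := Rabs_pos b1). assert (H5 := Rabs_pos (a1 * b1)).
  split; [nra|]. intros s p q t t' eta Hp Ht Heta Hx Hy Htt.
  assert (He : 0 <= eta) by (eapply Rle_trans; [apply Rabs_pos|exact Htt]).
  assert (Hmul : forall a, Rabs (a * (t' - t)) <= Rabs a * eta).
  { intros a. rewrite Rabs_mult. apply Rmult_le_compat_l; [apply Rabs_pos|exact Htt]. }
  assert (Ht'b : Rabs t' <= M + 1).
  { replace t' with (t + (t' - t)) by ring. eapply Rle_trans; [apply Rabs_triang|].
    rewrite (Rabs_right t) by lra. lra. }
  assert (Hxt : Rabs (fst q * t' - fst p * t) <= (2 * M + 1) * eta).
  { replace (fst q * t' - fst p * t) with ((fst q - fst p) * t' + fst p * (t' - t)) by ring.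
    eapply Rle_trans; [apply Rabs_triang|]. rewrite !Rabs_mult.
    assert (Q1 := Rabs_pos (fst q - fst p)). assert (Q2 := Rabs_pos (t' - t)).
    assert (Q3 := Rabs_pos (fst p)). assert (Q4 := Rabs_pos t').
    assert (Rabs (fst q - fst p) * Rabs t' <= eta * (M + 1)) by (apply Rmult_le_compat; lra).
    assert (Rabs (fst p) * Rabs (t' - t) <= M * eta) by (apply Rmult_le_compat; lra). lra. }
  assert (Htt2 : Rabs (t' ^ 2 - t ^ 2) <= 2 * ((2 * M + 1) * eta)).
  { replace (t' ^ 2 - t ^ 2) with ((t' - t) * (t' + t)) by ring. rewrite Rabs_mult.
    assert (Q : Rabs (t' + t) <= 2 * M + 1).
    { eapply Rle_trans; [apply Rabs_triang|]. rewrite (Rabs_right t) by lra. lra. }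
    assert (Q1 := Rabs_pos (t' - t)). assert (Q2 := Rabs_pos (t' + t)).
    assert (Rabs (t' - t) * Rabs (t' + t) <= eta * (2 * M + 1)) by (apply Rmult_le_compat; lra).
    nra. }
  assert (Hb1 : Rabs (b1 * (fst q * t' - fst p * t)) <= Rabs b1 * ((2 * M + 1) * eta)).
  { rewrite Rabs_mult. apply Rmult_le_compat_l; lra. }
  assert (Hab : Rabs (a1 * b1 * ((t' ^ 2 - t ^ 2) / 2)) <= Rabs (a1 * b1) * ((2 * M + 1) * eta)).
  { rewrite Rabs_mult. apply Rmult_le_compat_l; [lra|].
    unfold Rdiv. rewrite Rabs_mult, (Rabs_right (/ 2)) by lra. lra. }
  assert (P1 : 0 <= Rabs a1 * eta) by nra. assert (P2 : 0 <= Rabs a2 * eta) by nra.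
  assert (P3 : 0 <= Rabs b2 * eta) by nra.
  assert (P4 : 0 <= Rabs b1 * ((2 * M + 1) * eta))
    by (apply Rmult_le_pos; [lra|apply Rmult_le_pos; lra]).
  assert (P5 : 0 <= Rabs (a1 * b1) * ((2 * M + 1) * eta))
    by (apply Rmult_le_pos; [lra|apply Rmult_le_pos; lra]).
  destruct s; simpl fst; simpl snd; split.
  - replace (fst q + a1 * t' - (fst p + a1 * t)) with ((fst q - fst p) + a1 * (t' - t)) by ring.
    eapply Rle_trans; [apply Rabs_triang|]. specialize (Hmul a1). lra.
  - replace (snd q + b1 * fst q * t' + a1 * b1 * (t' * (t' * 1)) / 2
             - (snd p + b1 * fst p * t + a1 * b1 * (t * (t * 1)) / 2))
      with ((snd q - snd p) + b1 * (fst q * t' - fst p * t)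
            + a1 * b1 * ((t' ^ 2 - t ^ 2) / 2)) by field.
    eapply Rle_trans; [apply Rabs_triang|].
    assert (Q := Rabs_triang (snd q - snd p) (b1 * (fst q * t' - fst p * t))). lra.
  - replace (fst q + a2 * t' - (fst p + a2 * t)) with ((fst q - fst p) + a2 * (t' - t)) by ring.
    eapply Rle_trans; [apply Rabs_triang|]. specialize (Hmul a2). lra.
  - replace (snd q + b2 * t' - (snd p + b2 * t)) with ((snd q - snd p) + b2 * (t' - t)) by ring.
    eapply Rle_trans; [apply Rabs_triang|]. specialize (Hmul b2). lra.
Qed.

(** Arcs of nearby durations are close as sets: a time [t] on the arc from [q] is
    compared with the time [Rmin t b] on the arc from [p]. *)
Lemma arcs_close M :
  0 <= M -> exists C, 1 <= C /\ forall s p q b b' eta,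
    Rabs (fst p) <= M -> 0 <= b <= M -> eta <= 1 ->
    Rabs (fst q - fst p) <= eta -> Rabs (snd q - snd p) <= eta -> Rabs (b' - b) <= eta ->
    (forall t, 0 <= t <= b' -> exists t', 0 <= t' <= b /\
      Rabs (fst (flow s q t) - fst (flow s p t')) <= C * eta /\
      Rabs (snd (flow s q t) - snd (flow s p t')) <= C * eta).
Proof.
  intros HM. destruct (flow_close M HM) as [C [HC Hcl]]. exists C. split; [exact HC|].
  intros s p q b b' eta Hp Hb Heta Hx Hy Hbb t Ht.
  assert (He : 0 <= eta) by (eapply Rle_trans; [apply Rabs_pos|exact Hbb]).
  exists (Rmin t b).
  assert (Hm : 0 <= Rmin t b <= b) by (split; [apply Rmin_glb; lra|apply Rmin_r]).
  split; [exact Hm|]. apply Hcl; auto; [lra|].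
  apply Rabs_le_between in Hbb. apply Rabs_le_between.
  unfold Rmin in *; destruct (Rle_dec t b); lra.
Qed.

Section Cycle.
Hypothesis b2_pos : 0 < b2.

(** A cycle is the trajectory that repeats a lap from [w] to [w], together with
    its active field, which the position does not determine. *)
Definition is_cycle (Zc : R -> R * R) (mc : R -> side) (w beta : R) : Prop :=
  trajectory H Zc mc /\ exists td,
    returns Zc td (fun _ => w) (fun _ => beta) /\ td 0%nat = 0 /\
    (forall n t, 0 <= t < alpha -> mc (td n + t) = Minus) /\
    (forall n t, 0 <= t < beta -> mc (td n + alpha + t) = Plus).

Lemma cycle_exists w beta : lap w beta w -> exists Zc mc, is_cycle Zc mc w beta.
Proof.
  intros Hl. destruct (laps_trajectory (fun _ => w) (fun _ => beta) b2_pos (fun _ => Hl))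
    as [Zc [mc [td [Ht [Hr [H0 [Hm1 Hm2]]]]]]].
  exists Zc, mc. split; [exact Ht|]. exists td. auto.
Qed.

Section Fixed.
Variables (Zc : R -> R * R) (mc : R -> side) (w beta : R).
Hypothesis HC : is_cycle Zc mc w beta.

Lemma cycle_up t : 0 <= t <= alpha -> Zc t = flow Minus (w, - mu) t.
Proof.
  intros Ht. destruct HC as [_ [td [Hr [H0 _]]]].
  rewrite <- (returns_up _ _ _ _ Hr 0 t Ht), H0. f_equal. ring.
Qed.

Lemma cycle_down t : 0 <= t <= beta -> Zc (alpha + t) = flow Plus (w + delta, mu) t.
Proof.
  intros Ht. destruct HC as [_ [td [Hr [H0 _]]]].
  rewrite <- (returns_down _ _ _ _ Hr 0 t Ht), H0. f_equal. ring.
Qed.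

Lemma cycle_lap : lap w beta w.
Proof. destruct HC as [_ [td [Hr _]]]. exact (returns_lap _ _ _ _ Hr 0%nat). Qed.

Lemma cycle_cases t : 0 <= t ->
  (mc t = Minus /\ exists s, 0 <= s < alpha /\ Zc t = flow Minus (w, - mu) s) \/
  (mc t = Plus /\ exists s, 0 <= s < beta /\ Zc t = flow Plus (w + delta, mu) s).
Proof.
  intros Ht. destruct HC as [_ [td [Hr [H0 [Hm1 Hm2]]]]].
  destruct (returns_cover b2_pos _ _ _ _ Hr 0 t) as [n [_ [[s [Hs ->]]|[s [Hs ->]]]]]; [lra| |].
  - left. split; [now apply Hm1|]. exists s. split; [exact Hs|].
    apply (returns_up _ _ _ _ Hr). lra.
  - right. split; [now apply Hm2|]. exists s. split; [exact Hs|].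
    apply (returns_down _ _ _ _ Hr). lra.
Qed.

Lemma cycle_start : Zc 0 = (w, - mu) /\ mc 0 = Minus.
Proof.
  assert (Ha := alpha_pos b2_pos). split.
  - rewrite cycle_up by lra. apply flow_0.
  - destruct HC as [_ [td [Hr [H0 [Hm1 _]]]]].
    rewrite <- H0, <- (Rplus_0_r (td 0%nat)). apply Hm1. lra.
Qed.

Lemma cycle_periodic : periodic_trajectory H Zc mc.
Proof.
  assert (Ha := alpha_pos b2_pos). assert (Hb := proj1 cycle_lap).
  split; [apply HC|]. split.
  - exists (alpha + beta). split; [lra|]. intros t Ht.
    destruct HC as [_ [td [Hr [H0 _]]]].
    destruct (returns_cover b2_pos _ _ _ _ Hr 0 t) as [n [_ Hcase]]; [lra|].
    assert (Et := returns_time _ _ _ _ Hr n).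
    destruct Hcase as [[s [Hs ->]]|[s [Hs ->]]].
    + replace (td n + s + (alpha + beta)) with (td (n + 1)%nat + s) by (rewrite Et; ring).
      rewrite !(returns_up _ _ _ _ Hr) by lra. reflexivity.
    + replace (td n + alpha + s + (alpha + beta)) with (td (n + 1)%nat + alpha + s)
        by (rewrite Et; ring).
      rewrite !(returns_down _ _ _ _ Hr) by lra. reflexivity.
  - exists alpha. split; [lra|]. rewrite (proj1 cycle_start), cycle_up, flow_alpha by lra.
    intros E. injection E as _ E. lra.
Qed.

Lemma cycle_meets_HB : meets_HB H Zc.
Proof.
  exists (w, - mu). split.
  - exists 0. split; [lra|]. apply cycle_start.
  - split; simpl; lra.
Qed.

Lemma cycle_orbit_up t : 0 <= t <= alpha -> orbit Zc (flow Minus (w, - mu) t).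
Proof. intros Ht. exists t. split; [lra|now apply cycle_up]. Qed.

Lemma cycle_orbit_down t : 0 <= t <= beta -> orbit Zc (flow Plus (w + delta, mu) t).
Proof.
  assert (Ha := alpha_pos b2_pos).
  intros Ht. exists (alpha + t). split; [lra|now apply cycle_down].
Qed.

Lemma cycle_bounded : exists M, 0 <= M /\ alpha <= M /\ beta <= M /\
  Rabs w <= M /\ Rabs (w + delta) <= M /\
  forall p, orbit Zc p -> Rabs (fst p) <= M /\ Rabs (snd p) <= M.
Proof.
  assert (Ha := alpha_pos b2_pos). assert (Hb := proj1 cycle_lap).
  pose (M0 := Rmax (Rmax alpha beta) (Rmax (Rabs w) (Rabs (w + delta)))).
  assert (M1 : alpha <= M0) by (eapply Rle_trans; [apply Rmax_l|apply Rmax_l]).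
  assert (M2 : beta <= M0) by (eapply Rle_trans; [apply Rmax_r|apply Rmax_l]).
  assert (M3 : Rabs w <= M0) by (eapply Rle_trans; [apply Rmax_l|apply Rmax_r]).
  assert (M4 : Rabs (w + delta) <= M0) by (eapply Rle_trans; [apply Rmax_r|apply Rmax_r]).
  assert (Hgen : exists K, 0 <= K /\ forall s t, 0 <= t <= M0 ->
    let p := match s with Plus => (w + delta, mu) | Minus => (w, - mu) end in
    Rabs (fst (flow s p t)) <= K /\ Rabs (snd (flow s p t)) <= K).
  { exists (M0 + mu + (Rabs a1 + Rabs a2 + Rabs b2) * M0 + Rabs b1 * M0 * M0
            + Rabs (a1 * b1) * M0 * M0).
    assert (Q1 := Rabs_pos a1). assert (Q2 := Rabs_pos a2). assert (Q3 := Rabs_pos b2).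
    assert (Q4 := Rabs_pos b1). assert (Q5 := Rabs_pos (a1 * b1)).
    assert (R1 : 0 <= Rabs a1 * M0) by nra. assert (R2 : 0 <= Rabs a2 * M0) by nra.
    assert (R3 : 0 <= Rabs b2 * M0) by nra.
    assert (R4 : 0 <= Rabs b1 * M0 * M0) by (apply Rmult_le_pos; nra).
    assert (R5 : 0 <= Rabs (a1 * b1) * M0 * M0) by (apply Rmult_le_pos; nra).
    split; [nra|]. intros s t Ht.
    assert (Hmul : forall a, Rabs (a * t) <= Rabs a * M0).
    { intros a. rewrite Rabs_mult, (Rabs_right t) by lra.
      apply Rmult_le_compat_l; [apply Rabs_pos|lra]. }
    destruct s; simpl fst; simpl snd; split.
    - eapply Rle_trans; [apply Rabs_triang|]. specialize (Hmul a1). lra.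
    - assert (S1 : Rabs (b1 * (w + delta) * t) <= Rabs b1 * M0 * M0).
      { eapply Rle_trans; [apply Hmul|]. rewrite Rabs_mult.
        apply Rmult_le_compat_r; [lra|]. apply Rmult_le_compat_l; lra. }
      assert (S2 : Rabs (a1 * b1 * (t * (t * 1)) / 2) <= Rabs (a1 * b1) * M0 * M0).
      { replace (a1 * b1 * (t * (t * 1)) / 2) with (a1 * b1 * ((t / 2) * t)) by field.
        rewrite Rabs_mult, (Rabs_right (t / 2 * t)), Rmult_assoc by nra.
        apply Rmult_le_compat_l; [lra|]. nra. }
      eapply Rle_trans; [apply Rabs_triang|].
      assert (S3 := Rabs_triang mu (b1 * (w + delta) * t)).
      rewrite (Rabs_right mu) in S3 by lra. lra.
    - eapply Rle_trans; [apply Rabs_triang|]. specialize (Hmul a2). lra.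
    - eapply Rle_trans; [apply Rabs_triang|]. specialize (Hmul b2).
      rewrite Rabs_Ropp, (Rabs_right mu) by lra. lra. }
  destruct Hgen as [K [HK0 HK]].
  exists (M0 + K). repeat (split; [lra|]). intros p [t [Ht <-]].
  destruct (cycle_cases t Ht) as [[_ [s [Hs ->]]]|[_ [s [Hs ->]]]].
  - destruct (HK Minus s ltac:(lra)) as [K1 K2]. simpl in K1, K2 |- *. lra.
  - destruct (HK Plus s ltac:(lra)) as [K1 K2]. simpl in K1, K2 |- *. lra.
Qed.

Lemma near_orbit_of_le p q c e :
  orbit Zc p -> c < e -> Rabs (fst q - fst p) <= c -> Rabs (snd q - snd p) <= c ->
  near_orbit Zc e q.
Proof.
  intros Hp Hc H1 H2. exists p. split; [exact Hp|]. apply ball_RR. lra.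
Qed.

(** Late laps are uniformly close to the cycle, hence limit points belong to its
    closed orbit.  Conversely each point of the cycle is the limit of the points at
    the same stage of the successive laps. *)
Lemma convergence_to_cycle (Z : R -> R * R) (td v b : nat -> R) :
  returns Z td v b -> is_lim_seq v w -> is_lim_seq b beta ->
  omega_is Z (orbit_in_Rbar2 Zc).
Proof.
  intros HR Hv Hb. assert (Ha := alpha_pos b2_pos). assert (Hb0 := proj1 cycle_lap).
  destruct cycle_bounded as [M [HM0 [HM1 [HM2 [HM3 [HM4 HM]]]]]].
  destruct (arcs_close M HM0) as [C [HC1 Harc]].
  assert (Hclose : forall eta, 0 < eta -> exists N, forall n, (N <= n)%nat ->
            Rabs (v n - w) <= eta /\ Rabs (b n - beta) <= eta).
  { intros eta Heta. apply is_lim_seq_spec in Hv, Hb.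
    destruct (Hv (mkposreal _ Heta)) as [N1 H1]. destruct (Hb (mkposreal _ Heta)) as [N2 H2].
    exists (N1 + N2)%nat. intros n Hn. simpl in H1, H2.
    split; apply Rlt_le; [apply H1|apply H2]; lia. }
  assert (Hnear : forall eps, 0 < eps -> exists T, forall t, T <= t -> near_orbit Zc eps (Z t)).
  { intros eps Heps. pose (eta := Rmin 1 (eps / 2 / C)).
    assert (Heta : 0 < eta).
    { apply Rmin_glb_lt; [lra|]. apply Rdiv_lt_0_compat; lra. }
    assert (Heta1 : eta <= 1) by apply Rmin_l.
    assert (Heta2 : C * eta < eps).
    { assert (E := Rmin_r 1 (eps / 2 / C)). fold eta in E.
      apply (Rmult_le_compat_l C) in E; [|lra].
      replace (C * (eps / 2 / C)) with (eps / 2) in E by (field; lra). lra. }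
    destruct (Hclose eta Heta) as [N HN]. exists (td N). intros t Ht.
    destruct (returns_cover b2_pos _ _ _ _ HR N t Ht) as [n [Hn Hcase]].
    destruct (HN n Hn) as [E1 E2].
    destruct Hcase as [[s [Hs ->]]|[s [Hs ->]]].
    - rewrite (returns_up _ _ _ _ HR) by lra.
      destruct (Harc Minus (w, - mu) (v n, - mu) alpha alpha eta) with (t := s)
        as [s' [Hs' [D1 D2]]]; simpl; try (rewrite Rminus_diag, Rabs_R0); try lra.
      apply (near_orbit_of_le _ _ _ _ (cycle_orbit_up s' Hs') Heta2 D1 D2).
    - rewrite (returns_down _ _ _ _ HR) by lra.
      destruct (Harc Plus (w + delta, mu) (v n + delta, mu) beta (b n) eta) with (t := s)
        as [s' [Hs' [D1 D2]]]; simpl; try (rewrite Rminus_diag, Rabs_R0); try lra.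
      + replace (v n + delta - (w + delta)) with (v n - w) by ring. exact E1.
      + apply (near_orbit_of_le _ _ _ _ (cycle_orbit_down s' Hs') Heta2 D1 D2). }
  intros [w1 w2]. split.
  - intros [t [Ht [Hx Hy]]]. simpl in Hx, Hy.
    apply is_lim_seq_spec in Ht.
    assert (Hev : forall eps, 0 < eps -> exists N, forall n, (N <= n)%nat ->
              near_orbit Zc eps (Z (t n))).
    { intros eps Heps. destruct (Hnear eps Heps) as [T HT]. destruct (Ht T) as [N HN].
      exists N. intros n Hn. apply HT, Rlt_le, HN, Hn. }
    assert (Hfin : forall (g : R * R -> R) l,
              (forall p, orbit Zc p -> Rabs (g p) <= M) ->
              (forall p q e, ball q e p -> Rabs (g p - g q) < e) ->
              is_lim_seq (fun n => g (Z (t n))) l -> exists x : R, l = x).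
    { intros g l HgM Hgb Hl. destruct (Hev 1 Rlt_0_1) as [N HN].
      assert (HB : forall n, (N <= n)%nat -> - (M + 1) <= g (Z (t n)) <= M + 1).
      { intros n Hn. destruct (HN n Hn) as [q [Hq Hball]].
        apply Hgb in Hball. apply HgM in Hq.
        apply Rabs_def2 in Hball. apply Rabs_le_between in Hq. lra. }
      assert (L1 : Rbar_le l (M + 1)).
      { apply (is_lim_seq_le_loc (fun n => g (Z (t n))) (fun _ => M + 1)); auto.
        - exists N. intros n Hn. apply HB, Hn.
        - apply is_lim_seq_const. }
      assert (L2 : Rbar_le (- (M + 1)) l).
      { apply (is_lim_seq_le_loc (fun _ => - (M + 1)) (fun n => g (Z (t n)))); auto.
        - exists N. intros n Hn. apply HB, Hn.
        - apply is_lim_seq_const. }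
      destruct l as [x| |]; simpl in L1, L2; try tauto. now exists x. }
    destruct (Hfin fst w1) as [x ->]; auto.
    { intros p Hp. now apply HM. }
    { intros p q e Hpq. now apply (proj1 (ball_RR _ _ _)) in Hpq. }
    destruct (Hfin snd w2) as [y ->]; auto.
    { intros p Hp. now apply HM. }
    { intros p q e Hpq. now apply (proj1 (ball_RR _ _ _)) in Hpq. }
    exists (x, y). split; [|reflexivity].
    apply (periodic_orbit_closed Zc mc (x, y) cycle_periodic). intros eps Heps.
    assert (Heps2 : 0 < eps / 2) by lra.
    apply is_lim_seq_spec in Hx, Hy.
    destruct (Hx (mkposreal _ Heps2)) as [N1 H1]. destruct (Hy (mkposreal _ Heps2)) as [N2 H2].
    destruct (Hev _ Heps2) as [N3 H3]. simpl in H1, H2.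
    pose (n := (N1 + N2 + N3)%nat).
    assert (K1 := H1 n ltac:(unfold n; lia)). assert (K2 := H2 n ltac:(unfold n; lia)).
    destruct (H3 n ltac:(unfold n; lia)) as [q [Hq Hball]].
    apply (proj1 (ball_RR _ _ _)) in Hball. exists q. split; [exact Hq|]. apply ball_RR. simpl.
    destruct Hball as [B1 B2].
    apply Rabs_def2 in B1, B2, K1, K2. split; apply Rabs_def1; lra.
  - intros [p [[t [Ht Ep]] E]]. injection E as -> ->. rewrite <- Ep.
    destruct (cycle_cases t Ht) as [[_ [s [Hs Ez]]]|[_ [s [Hs Ez]]]]; rewrite Ez.
    + exists (fun n => td n + s). split; [|split].
      * apply is_lim_seq_plus with p_infty s; [apply (returns_to_infinity b2_pos _ _ _ _ HR)
          | apply is_lim_seq_const | reflexivity].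
      * apply (is_lim_seq_ext (fun n => v n + a2 * s)).
        -- intros n. now rewrite (returns_up _ _ _ _ HR) by lra.
        -- apply is_lim_seq_plus'; [exact Hv | apply is_lim_seq_const].
      * apply (is_lim_seq_ext (fun n => - mu + b2 * s)); [|apply is_lim_seq_const].
        intros n. now rewrite (returns_up _ _ _ _ HR) by lra.
    + (* the same fraction [s / beta] of each descending arc *)
      pose (c := s / beta).
      assert (Hc : 0 <= c < 1).
      { unfold c. split; [apply Rdiv_le_0_compat; lra|].
        apply (Rmult_lt_reg_r beta); [lra|]. unfold Rdiv.
        rewrite Rmult_assoc, Rinv_l by lra. lra. }
      assert (Hsc : s = beta * c) by (unfold c; field; lra).
      assert (Hbn : forall n, 0 <= b n * c <= b n).
      { intros n. assert (P := beta_pos _ _ _ _ HR n). nra. }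
      assert (Hbc : is_lim_seq (fun n => b n * c) s).
      { rewrite Hsc. apply is_lim_seq_mult'; [exact Hb|apply is_lim_seq_const]. }
      assert (Hvd : is_lim_seq (fun n => v n + delta) (w + delta)).
      { apply is_lim_seq_plus'; [exact Hv|apply is_lim_seq_const]. }
      exists (fun n => td n + alpha + b n * c). split; [|split].
      * apply is_lim_seq_plus with p_infty s; [|exact Hbc|reflexivity].
        apply is_lim_seq_plus with p_infty alpha;
          [apply (returns_to_infinity b2_pos _ _ _ _ HR)|apply is_lim_seq_const|reflexivity].
      * apply (is_lim_seq_ext (fun n => v n + delta + a1 * (b n * c))).
        -- intros n. now rewrite (returns_down _ _ _ _ HR) by apply Hbn.
        -- apply is_lim_seq_plus'; [exact Hvd|].
           apply is_lim_seq_mult'; [apply is_lim_seq_const|exact Hbc].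
      * apply (is_lim_seq_ext (fun n => mu + b1 * (v n + delta) * (b n * c)
                + a1 * b1 / 2 * ((b n * c) * (b n * c)))).
        -- intros n. rewrite (returns_down _ _ _ _ HR) by apply Hbn. simpl. field.
        -- simpl. replace (a1 * b1 * (s * (s * 1)) / 2) with (a1 * b1 / 2 * (s * s)) by field.
           repeat first [apply is_lim_seq_plus' | apply is_lim_seq_mult'
             | apply is_lim_seq_const | exact Hbc | exact Hv].
Qed.
End Fixed.
End Cycle.

(** * Zig-zags to infinity *)

Lemma periodic_not_type1 (Z : R -> R * R) m : periodic_trajectory H Z m -> ~ type1 Z.
Proof.
  intros HP [l1 [l2 [Hl1 [Hl2 Hom]]]].
  assert (H0 : orbit Z (Z 0)) by (exists 0; split; [lra|reflexivity]).
  apply (periodic_recurrent Z m _ HP) in H0. apply Hom in H0. injection H0 as E _.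
  destruct Hl1 as [-> | ->]; discriminate.
Qed.

Lemma periodic_not_type5 (Z : R -> R * R) m : periodic_trajectory H Z m -> ~ type5 H Z.
Proof.
  intros HP [_ [l [Hl [[Hlim _]|[lo [hi [_ [Hlim _]]]]]]]].
  - now apply (proj1 (periodic_no_escape Z m l HP Hl)).
  - now apply (proj2 (periodic_no_escape Z m l HP Hl)).
Qed.

Section ZigZag.
Hypothesis b2_pos : 0 < b2.

Lemma returns_shift Z td w beta k :
  returns Z td w beta ->
  returns Z (fun n => td (n + k)%nat) (fun n => w (n + k)%nat) (fun n => beta (n + k)%nat).
Proof.
  intros HR.
  assert (E : forall n, (n + 1 + k = n + k + 1)%nat) by (intros; lia).
  constructor.
  - apply (returns_nonneg b2_pos _ _ _ _ HR).
  - intros n. rewrite E. apply (returns_lap _ _ _ _ HR).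
  - intros n. rewrite E. apply (returns_time _ _ _ _ HR).
  - intros n. apply (returns_up _ _ _ _ HR).
  - intros n. apply (returns_down _ _ _ _ HR).
Qed.

(** The abscissa is affine on each leg, so it never falls behind that of the
    preceding touchdown by more than [Rabs delta].  The crossings are counted from
    [L^+], where the even ones start.  The sign [sg] is the direction of
    the escape. *)
Lemma zigzag_type5 (Z : R -> R * R) td w beta sg :
  returns Z td w beta -> sg = 1 \/ sg = -1 ->
  (forall n t, 0 < t <= beta n -> snd (flow Plus (w n + delta, mu) t) < mu) ->
  (forall n, sg * w n <= sg * w (n + 1)%nat) ->
  (forall M, exists n, M < sg * w n) ->
  type5 H Z.
Proof.
  intros HR Hsg Hdesc Hmono Hunb. assert (Ha := alpha_pos b2_pos).
  assert (Hb := beta_pos _ _ _ _ HR).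
  assert (Htime := returns_time _ _ _ _ HR).
  assert (Hup : forall n t, 0 <= t <= alpha ->
            fst (Z (td n + t)) = w n + a2 * t /\ snd (Z (td n + t)) = - mu + b2 * t).
  { intros n t Ht. now rewrite (returns_up _ _ _ _ HR) by exact Ht. }
  assert (Hba : b2 * alpha = 2 * mu) by (unfold alpha; field; lra).
  assert (Hdown : forall n t, 0 <= t <= beta n ->
            fst (Z (td n + alpha + t)) = w n + delta + a1 * t /\
            snd (Z (td n + alpha + t)) <= mu /\ - mu <= snd (Z (td n + alpha + t)) /\
            (0 < t < beta n -> - mu < snd (Z (td n + alpha + t)) < mu)).
  { intros n t Ht. rewrite (returns_down _ _ _ _ HR) by exact Ht.
    destruct (returns_lap _ _ _ _ HR n) as [_ [Hlow Hend]].
    split; [reflexivity|].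
    assert (L1 : 0 <= t < beta n -> - mu < snd (flow Plus (w n + delta, mu) t)) by apply Hlow.
    assert (L2 : t = beta n -> snd (flow Plus (w n + delta, mu) t) = - mu).
    { intros ->. now rewrite Hend. }
    assert (L3 : 0 < t -> snd (flow Plus (w n + delta, mu) t) < mu).
    { intros Hp. apply Hdesc. lra. }
    assert (L4 : t = 0 -> snd (flow Plus (w n + delta, mu) t) = mu).
    { intros ->. now rewrite flow_0. }
    destruct (Req_dec t 0) as [E0|E0]; destruct (Req_dec t (beta n)) as [E1|E1];
      try specialize (L2 E1); try specialize (L4 E0);
      try (assert (L1' := L1 ltac:(lra))); try (assert (L3' := L3 ltac:(lra))); repeat split; lra. }
  assert (Hland : forall n, w (n + 1)%nat = w n + delta + a1 * beta n).
  { intros n. assert (E := f_equal fst (landing _ _ _ _ HR n)). simpl in E. now rewrite E. }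
  assert (Hmono' : forall n k, sg * w n <= sg * w (n + k)%nat).
  { intros n. induction k as [|k IH]; [rewrite Nat.add_0_r; lra|].
    replace (n + S k)%nat with (n + k + 1)%nat by lia.
    specialize (Hmono (n + k)%nat). lra. }
  split.
  - exists (td 0%nat). split; [apply (returns_start _ _ _ _ HR)|]. intros t Ht.
    destruct (returns_cover b2_pos _ _ _ _ HR 0 t Ht) as [n [_ [[s [Hs ->]]|[s [Hs ->]]]]].
    + unfold in_HB. simpl. rewrite (proj2 (Hup n s ltac:(lra))). nra.
    + unfold in_HB. simpl. destruct (Hdown n s ltac:(lra)) as [_ [D1 [D2 _]]]. lra.
  - pose (l := if Rlt_dec 0 sg then p_infty else m_infty).
    exists l. split.
    { unfold l, infinite. destruct (Rlt_dec 0 sg); tauto. }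
    left. split.
    + assert (Hsx : forall M, exists T, forall t, T < t -> M < sg * fst (Z t)).
      { intros M. destruct (Hunb (M + Rabs delta)) as [N HN]. exists (td N). intros t Ht.
        destruct (returns_cover b2_pos _ _ _ _ HR N t ltac:(lra)) as [n [Hn Hcase]].
        assert (Hwn := Hmono' N (n - N)%nat). replace (N + (n - N))%nat with n in Hwn by lia.
        assert (Hw1 := Hmono n). rewrite Hland in Hw1.
        assert (Hsd : - Rabs delta <= sg * delta).
        { unfold Rabs. destruct (Rcase_abs delta); destruct Hsg; subst sg; lra. }
        destruct Hcase as [[s [Hs ->]]|[s [Hs ->]]].
        - rewrite (proj1 (Hup n s ltac:(lra))).
          assert (- Rabs delta <= sg * (a2 * s)); [|lra].
          (* [a2 * s] lies between 0 and [delta] *)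
          assert (Hfrac : a2 * s = delta * (s / alpha)) by (unfold delta; field; lra).
          assert (Hf : 0 <= s / alpha <= 1).
          { split; [apply Rdiv_le_0_compat; lra|]. apply (Rmult_le_reg_r alpha); [lra|].
            unfold Rdiv. rewrite Rmult_assoc, Rinv_l by lra. lra. }
          rewrite Hfrac. assert (Hd := Rabs_pos delta). nra.
        - rewrite (proj1 (Hdown n s ltac:(lra))).
          destruct (Rle_dec 0 (sg * a1)) as [Hp|Hneg]; [nra|].
          assert (sg * a1 * beta n <= sg * a1 * s) by nra.
          assert (Hd := Rabs_pos delta). lra. }
      apply is_lim_spec. unfold l. destruct (Rlt_dec 0 sg) as [Hp|Hneg]; intros M.
      * destruct (Hsx M) as [T HT]. exists T. intros t Ht. specialize (HT t Ht).
        destruct Hsg; subst sg; lra.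
      * destruct (Hsx (- M)) as [T HT]. exists T. intros t Ht. specialize (HT t Ht).
        destruct Hsg; subst sg; lra.
    + pose (s := fun k => if Nat.even k then td (Nat.div2 k) + alpha
                          else td (Nat.div2 k + 1)%nat).
      assert (Se : forall n, s (2 * n)%nat = td n + alpha).
      { intros n. unfold s. rewrite Nat.even_even, Nat.div2_double. reflexivity. }
      assert (So : forall n, s (2 * n + 1)%nat = td (n + 1)%nat).
      { intros n. unfold s. rewrite Nat.even_odd, (Nat.add_1_r (2 * n)), Nat.div2_succ_double.
        reflexivity. }
      assert (E1 : forall n, S (2 * n) = (2 * n + 1)%nat) by (intros; lia).
      assert (E2 : forall n, S (2 * n + 1) = (2 * (n + 1))%nat) by (intros; lia).
      exists s. split; [|split; [|split; [|split; [|split]]]].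
      * rewrite (Se 0%nat : s 0%nat = _). assert (H0 := returns_start _ _ _ _ HR). lra.
      * intros k. destruct (parity k) as [n [->| ->]].
        -- rewrite E1, Se, So, Htime. specialize (Hb n). lra.
        -- rewrite E2, Se, So. lra.
      * apply is_lim_seq_spec. intros M.
        destruct (returns_unbounded b2_pos _ _ _ _ HR M) as [N HN].
        exists (2 * N)%nat. intros k Hk. destruct (parity k) as [n [->| ->]].
        -- rewrite Se. assert (Hl := returns_le b2_pos _ _ _ _ HR N n ltac:(lia)). lra.
        -- rewrite So. assert (Hl := returns_le b2_pos _ _ _ _ HR N (n + 1) ltac:(lia)). lra.
      * intros k. destruct (parity k) as [n [->| ->]].
        -- rewrite Se, Nat.even_even, (proj2 (Hup n alpha ltac:(lra))). simpl. lra.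
        -- rewrite So, Nat.even_odd, <- (Rplus_0_r (td (n + 1)%nat)),
             (proj2 (Hup (n + 1)%nat 0 ltac:(lra))). simpl. ring.
      * intros k t. simpl Defs.mu. destruct (parity k) as [n [->| ->]].
        -- rewrite E1, Se, So, Htime. intros Ht.
           replace t with (td n + alpha + (t - td n - alpha)) by ring.
           apply Hdown; lra.
        -- rewrite E2, Se, So. intros Ht.
           replace t with (td (n + 1)%nat + (t - td (n + 1)%nat)) by ring.
           rewrite (proj2 (Hup (n + 1)%nat (t - td (n + 1)%nat) ltac:(lra))).
           assert (0 < b2 * (t - td (n + 1)%nat)) by (apply Rmult_lt_0_compat; lra).
           assert (b2 * (t - td (n + 1)%nat) < b2 * alpha) by (apply Rmult_lt_compat_l; lra).
           lra.
      * assert (Hm2 : forall k, sg * fst (Z (s k)) <= sg * fst (Z (s (S (S k))))).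
        { intros k. destruct (parity k) as [n [->| ->]].
          - replace (S (S (2 * n))) with (2 * (n + 1))%nat by lia.
            rewrite !Se, (proj1 (Hup n alpha ltac:(lra))),
              (proj1 (Hup (n + 1)%nat alpha ltac:(lra))).
            specialize (Hmono n). lra.
          - replace (S (S (2 * n + 1))) with (2 * (n + 1) + 1)%nat by lia.
            rewrite !So.
            rewrite <- (Rplus_0_r (td (n + 1)%nat)), <- (Rplus_0_r (td (n + 1 + 1)%nat)).
            rewrite (proj1 (Hup (n + 1)%nat 0 ltac:(lra))),
              (proj1 (Hup (n + 1 + 1)%nat 0 ltac:(lra))).
            specialize (Hmono (n + 1)%nat). lra. }
        destruct Hsg as [-> | ->]; [left|right]; intros k; specialize (Hm2 k); lra.
Qed.
End ZigZag.

(** * Invisible fold *)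

Lemma unbounded_of_squares (v : nat -> R) c k :
  0 < k -> (forall n, 0 <= v n) -> (forall n, c + INR n * k <= v n ^ 2) ->
  forall M, exists n, M < v n.
Proof.
  intros Hk Hv Hsq M. assert (Ht := is_lim_seq_affine c k Hk).
  apply is_lim_seq_spec in Ht. destruct (Ht (M ^ 2)) as [n Hn]. exists n.
  specialize (Hn n (Nat.le_refl n)). specialize (Hsq n). specialize (Hv n). simpl in *.
  destruct (Rlt_le_dec M (v n)) as [|Hle]; [assumption|]. nra.
Qed.

Section Scaled.
Hypothesis a1_neq : a1 <> 0.
Hypothesis b2_pos : 0 < b2.

(** In the abscissa [u = x / a1], [X^+] moves at unit speed and keeps
    [y - a1 * b1 * u ^ 2 / 2] constant. *)
Lemma flow_plus_scaled p t :
  fst (flow Plus p t) / a1 = fst p / a1 + t /\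
  snd (flow Plus p t) =
    snd p + a1 * b1 * ((fst p / a1 + t) ^ 2 - (fst p / a1) ^ 2) / 2.
Proof. simpl. split; field; exact a1_neq. Qed.

Let D := delta / a1.

(** The arc from [L^+] is the graph of a parabola over [u], and it ends when the
    square of [u] has changed by the amount that a descent of [2 mu] requires. *)
Lemma lap_scaled w beta w' :
  lap w beta w' <->
  0 < beta /\
  (forall t, 0 <= t < beta ->
     - (4 * mu) < a1 * b1 * ((w / a1 + D + t) ^ 2 - (w / a1 + D) ^ 2)) /\
  w' / a1 = w / a1 + D + beta /\
  a1 * b1 * ((w' / a1) ^ 2 - (w / a1 + D) ^ 2) = - (4 * mu).
Proof.
  assert (EF : forall t, flow Plus (w + delta, mu) t =
    (a1 * (w / a1 + D + t), mu + a1 * b1 * ((w / a1 + D + t) ^ 2 - (w / a1 + D) ^ 2) / 2)).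
  { intros t. unfold D. simpl. f_equal; field; exact a1_neq. }
  unfold lap. split.
  - intros [Hb [Hlow Hend]]. split; [exact Hb|]. rewrite EF in Hend.
    injection Hend as E1 E2. split; [|split].
    + intros t Ht. specialize (Hlow t Ht). rewrite EF in Hlow. simpl snd in Hlow. lra.
    + rewrite <- E1. field. exact a1_neq.
    + rewrite <- E1. replace (a1 * (w / a1 + D + beta) / a1) with (w / a1 + D + beta)
        by (field; exact a1_neq). lra.
  - intros [Hb [Hlow [E1 E2]]]. split; [exact Hb|]. split.
    + intros t Ht. specialize (Hlow t Ht). rewrite EF. simpl snd. simpl in Hlow. lra.
    + rewrite EF, <- E1. f_equal; [field; exact a1_neq|]. simpl in E2 |- *. lra.
Qed.

Lemma zigzag_scaled (Z : R -> R * R) td w beta tau :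
  returns Z td w beta -> tau = 1 \/ tau = -1 ->
  (forall n t, 0 < t <= beta n ->
     a1 * b1 * ((w n / a1 + D + t) ^ 2 - (w n / a1 + D) ^ 2) < 0) ->
  (forall n, tau * (w n / a1) <= tau * (w (n + 1)%nat / a1)) ->
  (forall M, exists n, M < tau * (w n / a1)) ->
  type5 H Z.
Proof.
  intros HR Htau Hdesc Hmono Hunb.
  pose (sa := if Rlt_dec 0 a1 then 1 else -1).
  assert (Hsa : (sa = 1 \/ sa = -1) /\ 0 < sa * a1).
  { unfold sa. destruct (Rlt_dec 0 a1); split; auto; lra. }
  destruct Hsa as [Hsa Hpos].
  assert (Ew : forall n, tau * sa * w n = sa * a1 * (tau * (w n / a1))).
  { intros n. field. exact a1_neq. }
  apply (zigzag_type5 b2_pos Z td w beta (tau * sa) HR).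
  - destruct Htau as [-> | ->], Hsa as [-> | ->]; lra.
  - intros n t Ht. destruct (flow_plus_scaled (w n + delta, mu) t) as [_ ->].
    replace (fst (w n + delta, mu) / a1) with (w n / a1 + D)
      by (unfold D; simpl; field; exact a1_neq).
    specialize (Hdesc n t Ht). simpl snd. lra.
  - intros n. rewrite !Ew. apply Rmult_le_compat_l; [lra|apply Hmono].
  - intros M. destruct (Hunb (M / (sa * a1))) as [n Hn]. exists n. rewrite Ew.
    apply (Rmult_lt_compat_l (sa * a1)) in Hn; [|exact Hpos].
    replace (sa * a1 * (M / (sa * a1))) with M in Hn by (field; nra). exact Hn.
Qed.

Section Invisible.
Hypothesis fold_invisible : a1 * b1 < 0.

Let K := - (4 * mu) / (a1 * b1).

Lemma K_pos : 0 < K /\ a1 * b1 * K = - (4 * mu).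
Proof.
  unfold K. set (B := a1 * b1) in *. split; [|field; lra].
  replace (- (4 * mu) / B) with (4 * mu / - B) by (field; lra).
  apply Rdiv_lt_0_compat; lra.
Qed.

(** The arc ends on the descending side of the vertex of its parabola. *)
Lemma landing_positive p b :
  0 < b -> - mu < snd p -> snd (flow Plus p b) = - mu -> 0 < fst p / a1 + b.
Proof.
  intros Hb Hp E. rewrite (proj2 (flow_plus_scaled p b)) in E.
  set (u := fst p / a1) in *.
  destruct (Rlt_le_dec 0 (u + b)) as [|Hle]; [assumption|].
  assert ((u + b) ^ 2 - u ^ 2 <= 0) by nra.
  assert (0 <= a1 * b1 * ((u + b) ^ 2 - u ^ 2)) by nra. lra.
Qed.

Lemma invisible_lap w beta w' :
  lap w beta w' ->
  0 < w' / a1 /\ w' / a1 = w / a1 + D + beta /\ (w' / a1) ^ 2 = (w / a1 + D) ^ 2 + K.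
Proof.
  intros Hl. destruct (proj1 (lap_scaled w beta w') Hl) as [Hb [_ [E1 E2]]].
  destruct K_pos as [_ HK].
  split; [|split; [exact E1|]].
  - destruct Hl as [_ [_ Hend]].
    assert (P := landing_positive (w + delta, mu) beta Hb ltac:(simpl; lra)
                   ltac:(rewrite Hend; reflexivity)).
    simpl in P. replace ((w + delta) / a1) with (w / a1 + D) in P
      by (unfold D; field; exact a1_neq). lra.
  - apply Rmult_eq_reg_l with (a1 * b1); lra.
Qed.

(** Touchdowns have [0 < u] from the second one on, and so does the rest of the
    motion when [0 <= D]: the arcs come down and the squares of the touchdown
    abscissae grow by at least [K]. *)
Lemma invisible_escape Z td w beta :
  returns Z td w beta -> 0 <= D -> type5 H Z.
Proof.
  intros HR0 HD. assert (HR := returns_shift b2_pos _ _ _ _ 1 HR0).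
  destruct K_pos as [HK _].
  assert (Hpos : forall n, 0 < w (n + 1)%nat / a1).
  { intros n. apply (invisible_lap _ _ _ (returns_lap _ _ _ _ HR0 n)). }
  assert (Hl := fun n => invisible_lap _ _ _ (returns_lap _ _ _ _ HR n)). cbv beta in Hl.
  assert (Hb := beta_pos _ _ _ _ HR).
  apply (zigzag_scaled Z _ _ _ 1 HR).
  - now left.
  - intros n t Ht. specialize (Hpos n).
    assert (0 < (w (n + 1)%nat / a1 + D + t) ^ 2 - (w (n + 1)%nat / a1 + D) ^ 2) by nra.
    nra.
  - intros n. destruct (Hl n) as [_ [E _]]. specialize (Hb n). lra.
  - intros M. destruct (unbounded_of_squares (fun n => w (n + 1)%nat / a1) 0 K HK) with (M := M)
      as [n Hn].
    + intros n. apply Rlt_le, Hpos.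
    + induction n as [|n IH].
      * simpl INR. assert (P := pow2_ge_0 (w (0 + 1)%nat / a1)). lra.
      * destruct (Hl n) as [_ [_ E]]. rewrite S_INR.
        replace (S n + 1)%nat with (n + 1 + 1)%nat by lia. rewrite E.
        specialize (Hpos n). nra.
    + exists n. lra.
Qed.

Section Cycle_invisible.
Hypothesis D_neg : D < 0.

(** The positive fixed point [V] of the scaled return map
    [v => sqrt ((v + D) ^ 2 + K)]. *)
Let V := (K + D ^ 2) / (2 * - D).

Lemma V_fixed : 0 < V /\ V ^ 2 = (V + D) ^ 2 + K.
Proof.
  destruct K_pos as [HK _]. unfold V. split.
  - apply Rdiv_lt_0_compat; [nra|lra].
  - field. lra.
Qed.

Lemma invisible_cycle_lap : lap (a1 * V) (- D) (a1 * V).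
Proof.
  destruct K_pos as [HK HK']. destruct V_fixed as [HV HV'].
  assert (EV : a1 * V / a1 = V) by (field; exact a1_neq).
  apply lap_scaled. rewrite EV. split; [lra|]. split; [|split; [ring|]].
  - intros t Ht. rewrite <- HK'.
    assert ((V + D + t) ^ 2 - (V + D) ^ 2 < K); [|nra].
    assert (E : - D * (2 * (V + D) - D) = K) by lra.
    replace ((V + D + t) ^ 2 - (V + D) ^ 2) with (t * (2 * (V + D) + t)) by ring.
    destruct (Rle_lt_dec (2 * (V + D) + t) 0); nra.
  - rewrite <- HK'. f_equal. lra.
Qed.

(** Subtracting the equations of the two squares, the ratio of the distances to
    [V] is [|v + V + 2 D| / (v' + V)], where [v' > |v + D|] and [V > |V + D|].
    On a set of bounded [v] it stays below a constant less than 1. *)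
Lemma return_map_contracts v v' A :
  0 < v' -> v' ^ 2 = (v + D) ^ 2 + K -> Rabs (v - V) + 2 * Rabs (V + D) <= A ->
  Rabs (v' - V) * (A + (V - Rabs (V + D))) <= Rabs (v - V) * A /\
  Rabs (v' - V) <= Rabs (v - V).
Proof.
  intros Hv' Ev' HA. destruct K_pos as [HK _]. destruct V_fixed as [HV EV].
  assert (Hroot : forall x y, 0 < x -> x ^ 2 = y ^ 2 + K -> Rabs y < x).
  { intros x y Hx E. rewrite <- (Rabs_right x) by lra. apply Rsqr_lt_abs_0.
    unfold Rsqr. nra. }
  assert (H1 := Hroot _ _ Hv' Ev'). assert (H2 := Hroot _ _ HV EV).
  assert (E : Rabs (v' - V) * (v' + V) = Rabs (v - V) * Rabs (v + V + 2 * D)).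
  { rewrite <- Rabs_mult. rewrite <- (Rabs_right (v' + V)) at 1 by lra.
    rewrite <- Rabs_mult. f_equal. nra. }
  assert (H3 : Rabs (v + V + 2 * D) <= Rabs (v + D) + Rabs (V + D)).
  { replace (v + V + 2 * D) with ((v + D) + (V + D)) by ring. apply Rabs_triang. }
  assert (H4 : Rabs (v + D) <= Rabs (v - V) + Rabs (V + D)).
  { replace (v + D) with ((v - V) + (V + D)) by ring. apply Rabs_triang. }
  assert (P1 := Rabs_pos (v' - V)). assert (P2 := Rabs_pos (v - V)).
  assert (P3 := Rabs_pos (V + D)). assert (P4 := Rabs_pos (v + D)).
  set (r' := Rabs (v' - V)) in *. set (r := Rabs (v - V)) in *.
  set (g := Rabs (V + D)) in *. set (h := Rabs (v + D)) in *.
  assert (Q : r' * (h + g + (V - g)) <= r * (h + g)).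
  { apply Rle_trans with (r' * (v' + V)); [apply Rmult_le_compat_l; lra|].
    rewrite E. apply Rmult_le_compat_l; lra. }
  assert (Hr : r' <= r).
  { destruct (Rle_lt_dec r' r) as [|Hgt]; [assumption|].
    assert (r * (h + g) <= r' * (h + g)) by (apply Rmult_le_compat_r; lra).
    assert (0 < r' * (V - g)) by (apply Rmult_lt_0_compat; lra). lra. }
  split; [|exact Hr].
  assert (r' * (A - h - g) <= r * (A - h - g)) by (apply Rmult_le_compat_r; lra). lra.
Qed.

Lemma invisible_landings_converge Z td w beta :
  returns Z td w beta ->
  (forall n, Rabs (w (n + 1)%nat / a1 - V) <= Rabs (w n / a1 - V)) /\
  is_lim_seq w (a1 * V) /\ is_lim_seq beta (- D).
Proof.
  intros HR. destruct V_fixed as [HV EV].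
  assert (Hl := fun n => invisible_lap _ _ _ (returns_lap _ _ _ _ HR n)).
  pose (A := Rabs (w 0%nat / a1 - V) + 2 * Rabs (V + D)).
  pose (g := V - Rabs (V + D)).
  assert (Hstep : forall n, Rabs (w (n + 1)%nat / a1 - V) <= Rabs (w n / a1 - V)).
  { intros n. destruct (Hl n) as [L1 [_ L2]].
    apply (return_map_contracts _ _ _ L1 L2 (Rle_refl _)). }
  assert (Hdec : forall n, Rabs (w n / a1 - V) <= Rabs (w 0%nat / a1 - V)).
  { induction n as [|n IH]; [lra|]. specialize (Hstep n). rewrite Nat.add_1_r in Hstep. lra. }
  assert (Hg : 0 < g).
  { unfold g. destruct K_pos as [HK _].
    assert (Rabs (V + D) < Rabs V); [|rewrite (Rabs_right V) in *; lra].
    apply Rsqr_lt_abs_0. unfold Rsqr. nra. }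
  assert (HA : 0 <= A).
  { unfold A. assert (P1 := Rabs_pos (w 0%nat / a1 - V)). assert (P2 := Rabs_pos (V + D)). lra. }
  pose (q := A / (A + g)).
  assert (Hq : 0 <= q < 1).
  { unfold q. split; [apply Rdiv_le_0_compat; lra|].
    apply (Rmult_lt_reg_r (A + g)); [lra|]. unfold Rdiv.
    rewrite Rmult_assoc, Rinv_l by lra. lra. }
  assert (Hgeo : forall n, Rabs (w n / a1 - V) <= q ^ n * Rabs (w 0%nat / a1 - V)).
  { induction n as [|n IH]; [simpl; lra|]. rewrite <- Nat.add_1_r.
    destruct (Hl n) as [L1 [_ L2]].
    destruct (return_map_contracts _ _ A L1 L2) as [Hc _].
    { specialize (Hdec n). unfold A. lra. }
    fold g in Hc.
    assert (Rabs (w (n + 1)%nat / a1 - V) <= q * Rabs (w n / a1 - V)).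
    { apply (Rmult_le_reg_r (A + g)); [lra|]. unfold q.
      replace (A / (A + g) * Rabs (w n / a1 - V) * (A + g)) with (Rabs (w n / a1 - V) * A)
        by (field; lra). exact Hc. }
    rewrite Nat.add_1_r in *. simpl.
    assert (q * Rabs (w n / a1 - V) <= q * (q ^ n * Rabs (w 0%nat / a1 - V)))
      by (apply Rmult_le_compat_l; lra). lra. }
  assert (Hv : is_lim_seq (fun n => w n / a1) V).
  { assert (H0 : is_lim_seq (fun n => w n / a1 - V) 0).
    { apply is_lim_seq_abs_0.
      apply (is_lim_seq_le_le (fun _ => 0) _ (fun n => q ^ n * Rabs (w 0%nat / a1 - V))).
      - intros n. split; [apply Rabs_pos|apply Hgeo].
      - apply is_lim_seq_const.
      - replace (Finite 0) with (Finite (0 * Rabs (w 0%nat / a1 - V))) by (f_equal; ring).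
        apply is_lim_seq_mult'; [|apply is_lim_seq_const].
        apply is_lim_seq_geom. rewrite Rabs_right; lra. }
    replace (Finite V) with (Finite (0 + V)) by (f_equal; ring).
    apply (is_lim_seq_ext (fun n => (w n / a1 - V) + V)); [intros; ring|].
    apply is_lim_seq_plus'; [exact H0|apply is_lim_seq_const]. }
  split; [exact Hstep|]. split.
  - apply (is_lim_seq_ext (fun n => a1 * (w n / a1))); [intros; field; exact a1_neq|].
    apply is_lim_seq_mult'; [apply is_lim_seq_const|exact Hv].
  - apply (is_lim_seq_ext (fun n => w (n + 1)%nat / a1 - w n / a1 - D)).
    + intros n. destruct (Hl n) as [_ [E _]]. rewrite E. ring.
    + replace (Finite (- D)) with (Finite (V - V - D)) by (f_equal; ring).
      apply is_lim_seq_minus'; [|apply is_lim_seq_const].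
      apply is_lim_seq_minus'; [|exact Hv].
      apply (is_lim_seq_ext (fun n => w (S n) / a1)); [intros; now rewrite Nat.add_1_r|].
      apply (proj1 (is_lim_seq_incr_1 (fun n => w n / a1) V)). exact Hv.
Qed.

Lemma invisible_attraction Zc mc Z m :
  is_cycle Zc mc (a1 * V) (- D) -> trajectory H Z m -> omega_is Z (orbit_in_Rbar2 Zc).
Proof.
  intros HC Ht. destruct (trajectory_dichotomy b2_pos Z m Ht) as [Hab|[td [w [beta HR]]]].
  - now apply invisible_not_above_forever in Hab.
  - destruct (invisible_landings_converge Z td w beta HR) as [_ [Hw Hb]].
    apply (convergence_to_cycle b2_pos Zc mc _ _ HC Z td w beta HR Hw Hb).
Qed.

Section Stability.
Variables (Zc : R -> R * R) (mc : R -> side).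
Hypothesis HC : is_cycle Zc mc (a1 * V) (- D).

Definition close (c : R) (q p : R * R) : Prop :=
  Rabs (fst q - fst p) <= c /\ Rabs (snd q - snd p) <= c.

Lemma close_near_orbit c eps q p : orbit Zc p -> c < eps -> close c q p -> near_orbit Zc eps q.
Proof. intros Hp Hc [H1 H2]. now apply (near_orbit_of_le Zc p q c eps). Qed.

(** A start close to a point of the cycle with the same active field gives a leg
    close to the cycle and a switch close to that of the cycle.  The durations of
    the two legs differ by the difference of the heights divided by [b2]. *)
Lemma rising_leg_close : exists C, 1 <= C /\ forall t0 q eta,
  0 <= t0 <= alpha -> close eta q (flow Minus (a1 * V, - mu) t0) -> C * eta <= 1 ->
  let r := (mu - snd q) / b2 in
  (forall t, 0 <= t <= r -> exists z, orbit Zc z /\ close (C * eta) (flow Minus q t) z) /\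
  close (C * eta) (flow Minus q r) (a1 * V + delta, mu).
Proof.
  destruct (cycle_bounded b2_pos Zc mc _ _ HC) as [M [HM0 [HM1 [_ [HM3 [_ HM]]]]]].
  destruct (arcs_close M HM0) as [C [HC1 Harc]].
  destruct (flow_close M HM0) as [C' [HC1' Hflow]].
  pose (c := 1 + / b2). assert (Hib : 0 < / b2) by now apply Rinv_0_lt_compat.
  exists ((C + C') * c). split; [unfold c; nra|].
  intros t0 q eta Ht0 [Hx Hy] Heta r.
  set (p := flow Minus (a1 * V, - mu) t0) in *.
  assert (He0 : 0 <= eta) by (eapply Rle_trans; [apply Rabs_pos|exact Hx]).
  assert (Hce : 0 <= c * eta) by (unfold c; nra).
  assert (Hce1 : c * eta <= 1) by nra.
  assert (Hec : eta <= c * eta) by (unfold c; nra).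
  assert (Hp : orbit Zc p) by now apply (cycle_orbit_up Zc mc _ _ HC).
  assert (Hr : Rabs (r - (alpha - t0)) <= c * eta).
  { assert (E : r - (alpha - t0) = - / b2 * (snd q - snd p)).
    { unfold r, p, alpha. simpl. field. lra. }
    rewrite E, Rabs_mult, Rabs_Ropp, (Rabs_right (/ b2)) by lra. unfold c. nra. }
  destruct (HM p Hp) as [Hpx _].
  split.
  - intros t Ht.
    destruct (Harc Minus p q (alpha - t0) r (c * eta)) with (t := t)
      as [t' [Ht' [D1 D2]]]; try lra.
    exists (flow Minus p t'). split.
    + unfold p. rewrite flow_add. apply (cycle_orbit_up Zc mc _ _ HC). lra.
    + split; nra.
  - assert (E : flow Minus p (alpha - t0) = (a1 * V + delta, mu)).
    { unfold p. rewrite flow_add. replace (t0 + (alpha - t0)) with alpha by ring.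
      now apply flow_alpha. }
    rewrite <- E.
    destruct (Hflow Minus p q (alpha - t0) r (c * eta)) as [D1 D2]; try lra.
    split; nra.
Qed.

(** The same for a leg of [X^+].  The conservation law controls the difference of
    the squares of the two landing abscissae [v] and [V]; as both are positive,
    dividing by [V] controls their difference, hence that of the durations. *)
Lemma falling_leg_close : exists C, 1 <= C /\ forall t0 q b eta,
  0 <= t0 <= - D -> close eta q (flow Plus (a1 * V + delta, mu) t0) -> C * eta <= 1 ->
  0 < b -> - mu < snd q -> snd (flow Plus q b) = - mu ->
  (forall t, 0 <= t <= b -> exists z, orbit Zc z /\ close (C * eta) (flow Plus q t) z) /\
  Rabs (fst (flow Plus q b) - a1 * V) <= C * eta.
Proof.
  destruct (cycle_bounded b2_pos Zc mc _ _ HC) as [M [HM0 [_ [HM1 [_ [_ HM]]]]]].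
  destruct (arcs_close M HM0) as [C [HC1 Harc]].
  destruct (flow_close M HM0) as [C' [HC1' Hflow]].
  destruct V_fixed as [HV _].
  assert (Hia : 0 < / Rabs a1) by (apply Rinv_0_lt_compat, Rabs_pos_lt, a1_neq).
  pose (B := - (a1 * b1)). assert (HB : 0 < B) by (unfold B; lra).
  assert (HiB : 0 < / B) by now apply Rinv_0_lt_compat.
  assert (HiV : 0 < / V) by now apply Rinv_0_lt_compat.
  pose (c0 := (/ Rabs a1 * ((2 * M + 1) * / Rabs a1) + 2 * / B) * / V).
  assert (Hc0 : 0 <= c0).
  { unfold c0. apply Rmult_le_pos; [|lra]. apply Rplus_le_le_0_compat; [|lra].
    apply Rmult_le_pos; [lra|]. apply Rmult_le_pos; lra. }
  pose (c := 1 + / Rabs a1 + c0).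
  exists ((C + C') * c). split; [unfold c; nra|].
  intros t0 q b eta Ht0 [Hx Hy] Heta Hb Hq Hend.
  set (p := flow Plus (a1 * V + delta, mu) t0) in *.
  assert (He0 : 0 <= eta) by (eapply Rle_trans; [apply Rabs_pos|exact Hx]).
  assert (Hc1 : 1 <= c) by (unfold c; lra).
  assert (Hce : 0 <= c * eta) by nra. assert (Hec : eta <= c * eta) by nra.
  assert (Hce1 : c * eta <= 1) by nra.
  assert (Hp : orbit Zc p) by now apply (cycle_orbit_down b2_pos Zc mc _ _ HC).
  destruct (HM p Hp) as [Hpx _].
  assert (Epend : flow Plus p (- D - t0) = (a1 * V, - mu)).
  { unfold p. rewrite flow_add. replace (t0 + (- D - t0)) with (- D) by ring.
    apply invisible_cycle_lap. }
  assert (Hcont : forall t, 0 <= t <= - D - t0 -> orbit Zc (flow Plus p t)).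
  { intros t Ht. unfold p. rewrite flow_add.
    apply (cycle_orbit_down b2_pos Zc mc _ _ HC). lra. }
  clearbody p.
  destruct (flow_plus_scaled p (- D - t0)) as [S1 S2].
  destruct (flow_plus_scaled q b) as [S3 S4].
  assert (Hv := landing_positive q b Hb Hq Hend).
  rewrite Epend in S1, S2. rewrite Hend in S4. simpl fst in S1. simpl snd in S2.
  replace (a1 * V / a1) with V in S1 by (field; exact a1_neq).
  rewrite <- S1 in S2.
  set (u := fst q / a1) in *. set (u' := fst p / a1) in *. set (v := u + b) in *.
  assert (Huu : Rabs (u - u') <= / Rabs a1 * eta).
  { replace (u - u') with (/ a1 * (fst q - fst p)) by (unfold u, u'; field; exact a1_neq).
    rewrite Rabs_mult, Rabs_inv. apply Rmult_le_compat_l; lra. }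
  assert (Hus : Rabs (u + u') <= (2 * M + 1) * / Rabs a1).
  { replace (u + u') with ((fst q + fst p) * / a1) by (unfold u, u'; field; exact a1_neq).
    rewrite Rabs_mult, Rabs_inv. apply Rmult_le_compat_r; [lra|].
    replace (fst q + fst p) with ((fst q - fst p) + 2 * fst p) by ring.
    eapply Rle_trans; [apply Rabs_triang|]. rewrite Rabs_mult, (Rabs_right 2) by lra. lra. }
  (* difference of the two conservation laws *)
  assert (Een : (v - V) * (v + V) = (u - u') * (u + u') + 2 * / B * (snd q - snd p)).
  { apply (Rmult_eq_reg_l B); [|lra].
    replace (B * ((u - u') * (u + u') + 2 * / B * (snd q - snd p)))
      with (B * ((u - u') * (u + u')) + 2 * (snd q - snd p)) by (field; lra).
    unfold B. lra. }
  assert (HvV : Rabs (v - V) <= c0 * eta).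
  { apply (Rmult_le_reg_r V); [exact HV|].
    replace (c0 * eta * V) with
      ((/ Rabs a1 * eta) * ((2 * M + 1) * / Rabs a1) + 2 * / B * eta)
      by (unfold c0; field; split; [|split]; [lra|lra|apply Rabs_no_R0, a1_neq]).
    apply Rle_trans with (Rabs (v - V) * (v + V)).
    { apply Rmult_le_compat_l; [apply Rabs_pos|lra]. }
    rewrite <- (Rabs_right (v + V)), <- Rabs_mult, Een by lra.
    eapply Rle_trans; [apply Rabs_triang|]. apply Rplus_le_compat.
    - rewrite Rabs_mult. apply Rmult_le_compat; auto using Rabs_pos.
    - rewrite Rabs_mult, (Rabs_right (2 * / B)) by lra. apply Rmult_le_compat_l; lra. }
  assert (Hbb : Rabs (b - (- D - t0)) <= c * eta).
  { replace (b - (- D - t0)) with ((v - V) + - (u - u')) by (unfold v; lra).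
    eapply Rle_trans; [apply Rabs_triang|]. rewrite Rabs_Ropp. unfold c. nra. }
  split.
  - intros t Ht.
    destruct (Harc Plus p q (- D - t0) b (c * eta)) with (t := t)
      as [t' [Ht' [D1 D2]]]; try lra.
    exists (flow Plus p t'). split; [now apply Hcont|]. split; nra.
  - destruct (Hflow Plus p q (- D - t0) b (c * eta)) as [D1 _]; try lra.
    rewrite Epend in D1. simpl fst in D1 at 2. nra.
Qed.

(** Errors do not accumulate: a loop multiplies them by a constant at most, and the
    touchdowns never move away from that of the cycle.  The initial phase costs
    a factor [C1 * C2] at most, and a loop another one. *)
Lemma invisible_stable : stable H Zc mc.
Proof.
  intros eps Heps.
  destruct rising_leg_close as [C1 [HC1 Hrise]].
  destruct falling_leg_close as [C2 [HC2 Hfall]].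
  pose (C := C1 * C2 * (C1 * C2)).
  assert (H12 : 1 <= C1 * C2) by nra.
  assert (HC0 : 1 <= C) by (unfold C; nra).
  pose (eta := Rmin 1 (eps / 2) / C).
  assert (Hmin : 0 < Rmin 1 (eps / 2)) by (apply Rmin_glb_lt; lra).
  assert (Heta : 0 < eta) by (apply Rdiv_lt_0_compat; lra).
  assert (HCe : C * eta = Rmin 1 (eps / 2)) by (unfold eta; field; lra).
  assert (HCe1 : C * eta <= 1) by (rewrite HCe; apply Rmin_l).
  assert (HCe2 : C * eta < eps) by (rewrite HCe; assert (Q := Rmin_r 1 (eps / 2)); lra).
  assert (G1 : C1 * eta <= C * eta) by (apply Rmult_le_compat_r; [lra|unfold C; nra]).
  assert (G2 : C2 * (C1 * eta) <= C * eta).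
  { replace (C2 * (C1 * eta)) with (C1 * C2 * eta) by ring.
    apply Rmult_le_compat_r; [lra|unfold C; nra]. }
  assert (G3 : C2 * eta <= C1 * C2 * eta) by (apply Rmult_le_compat_r; nra).
  assert (G4 : C1 * (C1 * C2 * eta) <= C * eta).
  { replace (C1 * (C1 * C2 * eta)) with (C1 * (C1 * C2) * eta) by ring.
    apply Rmult_le_compat_r; [lra|unfold C]. apply Rmult_le_compat_r; nra. }
  assert (G5 : C2 * (C1 * (C1 * C2 * eta)) = C * eta) by (unfold C; ring).
  assert (G6 : C1 * C2 * eta <= C * eta) by (rewrite <- (Rmult_1_l (C1 * C2 * eta));
    unfold C; rewrite (Rmult_assoc (C1 * C2)); apply Rmult_le_compat_r; nra).
  exists eta. split; [exact Heta|]. intros Z m Ht [s [Hs [Hball Hms]]].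
  assert (Hna := invisible_not_above_forever Z fold_invisible).
  destruct (first_touchdown b2_pos Z m Ht Hna)
    as [r [b [Hr [Hb [Htd [Hmode [Eup [Edown Hlow]]]]]]]].
  destruct (returns_from b2_pos Z (r + b) (proj1 Ht) Hna Htd) as [td [w [beta [HR Htd0]]]].
  assert (Hclose0 : close eta (Z 0) (Zc s)).
  { apply (proj1 (ball_RR _ _ _)) in Hball. split; apply Rlt_le; apply Hball. }
  assert (Hyend : snd (flow Plus (Z r) b) = - mu).
  { rewrite <- Edown by lra. apply Htd. }
  assert (Hw0 : w 0%nat = fst (flow Plus (Z r) b)).
  { rewrite <- Edown, <- Htd0, <- (Rplus_0_r (td 0%nat)) by lra.
    rewrite (returns_up _ _ _ _ HR) by (assert (Q := alpha_pos b2_pos); lra).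
    now rewrite flow_0. }
  assert (Hyr : - mu < snd (Z r)).
  { rewrite <- (flow_0 Plus (Z r)). apply Hlow. lra. }
  assert (Hnear : forall q, (exists z, orbit Zc z /\ close (C * eta) q z) -> near_orbit Zc eps q).
  { intros q [z [Hz Hcz]]. now apply (close_near_orbit (C * eta) eps q z). }
  assert (Hmon : forall c c' q z, c <= c' -> close c q z -> close c' q z).
  { intros c c' q z Hc [Q1 Q2]. split; lra. }
  (* the initial phase, up to the first touchdown *)
  assert (Hinit : (forall t, 0 <= t <= r + b -> near_orbit Zc eps (Z t)) /\
                  Rabs (w 0%nat - a1 * V) <= C1 * C2 * eta).
  { destruct (cycle_cases b2_pos Zc mc _ _ HC s Hs) as [[Em [t0 [Ht0 Es]]]|[Em [t0 [Ht0 Es]]]];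
      rewrite Es in Hclose0; rewrite Hms, Em in Hmode; destruct Hmode as [Er Hy0].
    - destruct (Hrise t0 (Z 0) eta) as [R1 R2]; [lra|exact Hclose0|lra|].
      rewrite <- Er in R1, R2. rewrite <- Eup in R2 by lra.
      destruct (Hfall 0 (Z r) b (C1 * eta)) as [F1 F2]; auto; [lra|now rewrite flow_0|lra|].
      split.
      + intros t Htt. destruct (Rle_lt_dec t r) as [Hle|Hgt].
        * rewrite Eup by lra. apply Hnear. destruct (R1 t) as [z [Hz Hcz]]; [lra|].
          exists z. split; [exact Hz|]. now apply (Hmon (C1 * eta)).
        * replace t with (r + (t - r)) by ring. rewrite Edown by lra. apply Hnear.
          destruct (F1 (t - r)) as [z [Hz Hcz]]; [lra|].
          exists z. split; [exact Hz|]. now apply (Hmon (C2 * (C1 * eta))).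
      + rewrite Hw0. lra.
    - subst r.
      destruct (Hfall t0 (Z 0) b eta) as [F1 F2]; auto; [lra|lra|].
      split.
      + intros t Htt. replace t with (0 + t) by ring. rewrite Edown by lra. apply Hnear.
        destruct (F1 t) as [z [Hz Hcz]]; [lra|].
        exists z. split; [exact Hz|]. apply (Hmon (C2 * eta)); [lra|exact Hcz].
      + rewrite Hw0. lra. }
  destruct Hinit as [Hphase Hw].
  destruct (invisible_landings_converge Z td w beta HR) as [Hdec _].
  assert (Hwn : forall n, Rabs (w n - a1 * V) <= C1 * C2 * eta).
  { induction n as [|n IH]; [exact Hw|]. rewrite <- Nat.add_1_r.
    eapply Rle_trans; [|exact IH].
    assert (E : forall k, Rabs (w k - a1 * V) = Rabs a1 * Rabs (w k / a1 - V)).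
    { intros k. rewrite <- Rabs_mult. f_equal. field. exact a1_neq. }
    rewrite !E. apply Rmult_le_compat_l; [apply Rabs_pos|apply Hdec]. }
  intros t Ht0. destruct (Rle_lt_dec t (r + b)) as [Hle|Hgt]; [apply Hphase; lra|].
  assert (Ha := alpha_pos b2_pos).
  destruct (returns_cover b2_pos _ _ _ _ HR 0 t) as [n [_ Hcase]]; [lra|].
  destruct (Hrise 0 (w n, - mu) (C1 * C2 * eta)) as [R1 R2]; [lra| |lra|].
  { rewrite flow_0. split; simpl; [apply Hwn|]. rewrite Rminus_diag, Rabs_R0. nra. }
  simpl snd in R1, R2. replace ((mu - - mu) / b2) with alpha in R1, R2
    by (unfold alpha; field; lra).
  rewrite flow_alpha in R2 by exact b2_pos.
  destruct Hcase as [[t' [Ht' ->]]|[t' [Ht' ->]]]; apply Hnear.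
  - rewrite (returns_up _ _ _ _ HR) by lra. destruct (R1 t') as [z [Hz Hcz]]; [lra|].
    exists z. split; [exact Hz|]. now apply (Hmon (C1 * (C1 * C2 * eta))).
  - rewrite (returns_down _ _ _ _ HR) by lra.
    destruct (Hfall 0 (w n + delta, mu) (beta n) (C1 * (C1 * C2 * eta))) as [F1 _].
    + lra.
    + now rewrite flow_0.
    + lra.
    + apply (beta_pos _ _ _ _ HR).
    + simpl. lra.
    + now rewrite (landing _ _ _ _ HR).
    + destruct (F1 t') as [z [Hz Hcz]]; [lra|]. exists z. split; [exact Hz|].
      now rewrite G5 in Hcz.
Qed.
End Stability.

Lemma invisible_limit_cycle Z m :
  trajectory H Z m ->
  type3 H (visible_fold a1 b1) (invisible_fold a1 b1) Z.
Proof.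
  intros Ht. destruct (cycle_exists b2_pos _ _ invisible_cycle_lap) as [Zc [mc HC]].
  exists Zc, mc. split; [split|split; [|split]].
  - apply (cycle_periodic b2_pos Zc mc _ _ HC).
  - apply isolated_of_attraction. intros Z' m' [Ht' _].
    now apply (invisible_attraction Zc mc Z' m').
  - apply (cycle_meets_HB b2_pos Zc mc _ _ HC).
  - now apply (invisible_attraction Zc mc Z m).
  - left. split; [exact fold_invisible|]. split.
    + now apply invisible_stable.
    + exists 1. split; [lra|]. intros Z' m' Ht' _. now apply (invisible_attraction Zc mc Z' m').
Qed.
End Cycle_invisible.
End Invisible.

(** * Visible fold *)

Section Visible.
Hypothesis fold_visible : 0 < a1 * b1.

Let c := 4 * mu / (a1 * b1).

Lemma c_pos : 0 < c /\ a1 * b1 * c = 4 * mu.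
Proof.
  unfold c. set (B := a1 * b1) in *. split; [|field; lra]. apply Rdiv_lt_0_compat; lra.
Qed.

Lemma visible_lap w beta w' :
  lap w beta w' ->
  w' / a1 <= 0 /\ w / a1 + D < w' / a1 /\ (w' / a1) ^ 2 = (w / a1 + D) ^ 2 - c.
Proof.
  intros Hl. destruct (proj1 (lap_scaled w beta w') Hl) as [Hb [Hlow [E1 E2]]].
  destruct c_pos as [Hc Hc'].
  set (u := w / a1 + D) in *. set (v' := w' / a1) in *.
  assert (Esq : v' ^ 2 = u ^ 2 - c) by (apply Rmult_eq_reg_l with (a1 * b1); lra).
  split; [|split; [lra|exact Esq]].
  destruct (Rle_lt_dec v' 0) as [|Hpos]; [assumption|exfalso].
  (* the parabola already met the same height at the abscissa [- v'] *)
  assert (Hu : u < - v') by nra.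
  specialize (Hlow (- v' - u) ltac:(lra)).
  replace (u + (- v' - u)) with (- v') in Hlow by ring.
  replace ((- v') ^ 2) with (v' ^ 2) in Hlow by ring. lra.
Qed.

Lemma squares_cannot_decrease_forever (v : nat -> R) k :
  0 < k -> ~ (forall n, v (n + 1)%nat ^ 2 <= v n ^ 2 - k).
Proof.
  intros Hk Hdec.
  assert (Hn : forall n, v n ^ 2 <= v 0%nat ^ 2 - INR n * k).
  { induction n as [|n IH]; [simpl INR; lra|]. rewrite S_INR.
    specialize (Hdec n). rewrite Nat.add_1_r in Hdec. lra. }
  assert (Ht := is_lim_seq_affine 0 k Hk). apply is_lim_seq_spec in Ht.
  destruct (Ht (v 0%nat ^ 2)) as [n Hn']. specialize (Hn' n (Nat.le_refl n)).
  specialize (Hn n). assert (P := pow2_ge_0 (v n)). lra.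
Qed.

Lemma visible_no_returns Z td w beta : 0 <= D -> ~ returns Z td w beta.
Proof.
  intros HD HR. destruct c_pos as [Hc _].
  assert (Hl := fun n => visible_lap _ _ _ (returns_lap _ _ _ _ HR n)).
  apply (squares_cannot_decrease_forever (fun n => w (n + 1)%nat / a1) c Hc). intros n.
  destruct (Hl n) as [L1 _]. destruct (Hl (n + 1)%nat) as [L2 [L3 ->]].
  assert (w (n + 1)%nat / a1 + D <= 0) by lra. nra.
Qed.

Section Leftward.
Hypothesis D_neg : D < 0.

(** The fixed point [V] of the scaled return map [v => - sqrt ((v + D) ^ 2 - c)];
    there is one only if [V <= 0]. *)
Let V := (c - D ^ 2) / (2 * D).

Lemma square_increment v v' : v' ^ 2 = (v + D) ^ 2 - c -> v' ^ 2 = v ^ 2 + 2 * - D * (V - v).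
Proof. intros ->. unfold V. field. lra. Qed.

Lemma visible_growth (v : nat -> R) :
  (forall n, v n <= 0) -> (forall n, v (n + 1)%nat ^ 2 = (v n + D) ^ 2 - c) -> v 0%nat < V ->
  (forall n, v (n + 1)%nat <= v n) /\ (forall n, v n <= v 0%nat) /\
  (forall M, exists n, M < - v n).
Proof.
  intros Hv Hrec H0. pose (k := 2 * - D * (V - v 0%nat)).
  assert (Hk : 0 < k) by (unfold k; nra).
  assert (Hstep : forall n, v n <= v 0%nat ->
            v n ^ 2 + k <= v (n + 1)%nat ^ 2 /\ v (n + 1)%nat <= v n).
  { intros n Hn. rewrite (square_increment (v n) _ (Hrec n)).
    assert (Hk' : k <= 2 * - D * (V - v n)) by (unfold k; apply Rmult_le_compat_l; lra).
    split; [lra|].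
    assert (E := square_increment (v n) _ (Hrec n)).
    assert (Q1 := Hv n). assert (Q2 := Hv (n + 1)%nat). nra. }
  assert (Hle : forall n, v n <= v 0%nat).
  { induction n as [|n IH]; [lra|]. destruct (Hstep n IH) as [_ Q].
    rewrite Nat.add_1_r in Q. lra. }
  split; [intros n; apply Hstep, Hle|]. split; [exact Hle|].
  apply (unbounded_of_squares (fun n => - v n) 0 k Hk).
  - intros n. specialize (Hv n). lra.
  - induction n as [|n IH].
    + simpl INR. assert (P := pow2_ge_0 (- v 0%nat)). lra.
    + destruct (Hstep n (Hle n)) as [Q _]. rewrite Nat.add_1_r in Q. rewrite S_INR.
      replace ((- v (S n)) ^ 2) with (v (S n) ^ 2) by ring.
      replace ((- v n) ^ 2) with (v n ^ 2) in IH by ring. lra.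
Qed.

(** By [square_increment], the squares of the touchdown abscissae, which are
    nonpositive, increase forever from a start beyond [V] and would decrease
    forever, by a fixed amount, from a start inside. *)
Lemma visible_returns Z td w beta :
  returns Z td w beta ->
  type5 H Z \/ (V <= 0 /\ forall n, w (n + 1)%nat = a1 * V /\ beta (n + 1)%nat = - D).
Proof.
  intros HR0. assert (HR := returns_shift b2_pos _ _ _ _ 1 HR0).
  assert (Hneg : forall n, w (n + 1)%nat / a1 <= 0).
  { intros n. apply (visible_lap _ _ _ (returns_lap _ _ _ _ HR0 n)). }
  assert (Hl := fun n => visible_lap _ _ _ (returns_lap _ _ _ _ HR n)). cbv beta in Hl.
  assert (Hrec := fun n => proj2 (proj2 (Hl n))).
  destruct (Rtotal_order (w (0 + 1)%nat / a1) V) as [Hlt|[Heq|Hgt]].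
  - left. destruct (visible_growth (fun n => w (n + 1)%nat / a1) Hneg Hrec Hlt)
      as [Hmono [_ Hunb]].
    apply (zigzag_scaled Z _ _ _ (-1) HR).
    + now right.
    + intros n t Ht. destruct (Hl n) as [L1 [L2 _]].
      destruct (proj1 (lap_scaled _ _ _) (returns_lap _ _ _ _ HR n)) as [_ [_ [E _]]].
      set (u := w (n + 1)%nat / a1 + D) in *.
      assert ((u + t) ^ 2 - u ^ 2 < 0) by nra. nra.
    + intros n. specialize (Hmono n). lra.
    + intros M. destruct (Hunb M) as [n Hn]. exists n. lra.
  - right. assert (HV : V <= 0) by (rewrite <- Heq; apply Hneg). split; [exact HV|].
    assert (Hfix : forall n, w (n + 1)%nat / a1 = V).
    { induction n as [|n IH]; [exact Heq|].
      replace (S n + 1)%nat with (n + 1 + 1)%nat by lia.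
      assert (E := square_increment _ _ (Hrec n)). rewrite IH in E.
      assert (Q := Hneg (n + 1)%nat). nra. }
    intros n. split.
    + rewrite <- (Hfix n). field. exact a1_neq.
    + destruct (proj1 (lap_scaled _ _ _) (returns_lap _ _ _ _ HR n)) as [_ [_ [E _]]].
      rewrite !Hfix in E. lra.
  - exfalso. pose (k := 2 * - D * (w (0 + 1)%nat / a1 - V)).
    assert (Hk : 0 < k) by (unfold k; nra).
    assert (Hstep : forall n, w (0 + 1)%nat / a1 <= w (n + 1)%nat / a1 ->
              (w (n + 1 + 1)%nat / a1) ^ 2 <= (w (n + 1)%nat / a1) ^ 2 - k).
    { intros n Hn. rewrite (square_increment _ _ (Hrec n)).
      assert (k <= 2 * - D * (w (n + 1)%nat / a1 - V))
        by (unfold k; apply Rmult_le_compat_l; lra). lra. }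
    assert (Hge : forall n, w (0 + 1)%nat / a1 <= w (n + 1)%nat / a1).
    { induction n as [|n IH]; [lra|]. specialize (Hstep n IH).
      replace (S n + 1)%nat with (n + 1 + 1)%nat by lia.
      assert (Q1 := Hneg n). assert (Q2 := Hneg (n + 1)%nat). nra. }
    apply (squares_cannot_decrease_forever (fun n => w (n + 1)%nat / a1) k Hk).
    intros n. apply Hstep, Hge.
Qed.

Lemma visible_trajectories Z m :
  trajectory H Z m ->
  type1 Z \/ type5 H Z \/
  (V <= 0 /\ forall Zc mc, is_cycle Zc mc (a1 * V) (- D) -> omega_is Z (orbit_in_Rbar2 Zc)).
Proof.
  intros Ht. destruct (trajectory_dichotomy b2_pos Z m Ht) as [Hab|[td [w [beta HR]]]].
  - left. destruct (above_forever_type Z) as [|[[E _]|[E _]]]; auto; nra.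
  - right. destruct (visible_returns Z td w beta HR) as [H5|[HV Hfix]]; [now left|].
    right. split; [exact HV|]. intros Zc mc HC.
    apply (convergence_to_cycle b2_pos Zc mc _ _ HC Z _ _ _ (returns_shift b2_pos _ _ _ _ 1 HR)).
    + apply (is_lim_seq_ext (fun _ => a1 * V)); [|apply is_lim_seq_const].
      intros n. symmetry. apply Hfix.
    + apply (is_lim_seq_ext (fun _ => - D)); [|apply is_lim_seq_const].
      intros n. symmetry. apply Hfix.
Qed.

Section Cycle_visible.
Hypothesis V_nonpos : V <= 0.

Lemma lap_of_landing v v' :
  v' <= 0 -> v + D < v' -> v' ^ 2 = (v + D) ^ 2 - c ->
  lap (a1 * v) (v' - v - D) (a1 * v').
Proof.
  intros Hv' Hlt E. destruct c_pos as [_ Hc].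
  apply lap_scaled. replace (a1 * v / a1) with v by (field; exact a1_neq).
  replace (a1 * v' / a1) with v' by (field; exact a1_neq).
  split; [lra|]. split; [|split; [ring|rewrite E, <- Hc; ring]].
  intros t Ht. rewrite <- Hc.
  assert (v' ^ 2 < (v + D + t) ^ 2) by nra. nra.
Qed.

Lemma visible_cycle_lap : lap (a1 * V) (- D) (a1 * V).
Proof.
  replace (- D) with (V - V - D) by ring. apply lap_of_landing; [exact V_nonpos|lra|].
  unfold V. field. lra.
Qed.

(** A trajectory that starts on [L^-] just beyond the cycle zig-zags away from it. *)
Lemma visible_unstable Zc mc : is_cycle Zc mc (a1 * V) (- D) -> unstable H Zc mc.
Proof.
  intros HC Hst. destruct (Hst 1 Rlt_0_1) as [d [Hd Hnear]].
  assert (Ha1 := Rabs_pos_lt a1 a1_neq).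
  pose (eta := d / 2 / Rabs a1).
  assert (Heta : 0 < eta) by (unfold eta; apply Rdiv_lt_0_compat; lra).
  pose (v := fix v n := match n with O => V - eta | S n => - sqrt ((v n + D) ^ 2 - c) end).
  assert (Hinv : forall n, v n < V /\ 0 <= (v n + D) ^ 2 - c).
  { assert (Hsq : forall x, x < V -> x ^ 2 < (x + D) ^ 2 - c).
    { intros x Hx.
      assert (E : (x + D) ^ 2 - c = x ^ 2 + 2 * - D * (V - x)) by (unfold V; field; lra).
      rewrite E. nra. }
    assert (Hlt : forall n, v n < V).
    { induction n as [|n IH]; [simpl; lra|].
      assert (Q := Hsq (v n) IH). assert (P := pow2_ge_0 (v n)).
      assert (Q' : sqrt (v n ^ 2) <= sqrt ((v n + D) ^ 2 - c)) by (apply sqrt_le_1_alt; lra).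
      replace (v n ^ 2) with (Rsqr (v n)) in Q' by (unfold Rsqr; ring).
      rewrite sqrt_Rsqr_abs in Q'. assert (Q2 := Rle_abs (- v n)). rewrite Rabs_Ropp in Q2.
      change (- sqrt ((v n + D) ^ 2 - c) < V). lra. }
    intros n. split; [apply Hlt|]. specialize (Hsq (v n) (Hlt n)).
    assert (P := pow2_ge_0 (v n)). lra. }
  assert (Hsucc : forall n, v (n + 1)%nat = - sqrt ((v n + D) ^ 2 - c)).
  { intros n. rewrite Nat.add_1_r. reflexivity. }
  assert (Hneg : forall n, v n <= 0) by (intros n; destruct (Hinv n); lra).
  assert (Hrec : forall n, v (n + 1)%nat ^ 2 = (v n + D) ^ 2 - c).
  { intros n. rewrite Hsucc. replace ((- sqrt ((v n + D) ^ 2 - c)) ^ 2)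
      with (sqrt ((v n + D) ^ 2 - c) * sqrt ((v n + D) ^ 2 - c)) by ring.
    apply sqrt_sqrt, Hinv. }
  assert (Hlap : forall n, lap (a1 * v n) (v (n + 1)%nat - v n - D) (a1 * v (n + 1)%nat)).
  { intros n. apply lap_of_landing; [apply Hneg| |apply Hrec].
    assert (Q1 := Hneg n). assert (Q2 := Hneg (n + 1)%nat). assert (Q3 := Hrec n).
    destruct c_pos as [Hc _]. nra. }
  destruct (laps_trajectory (fun n => a1 * v n) (fun n => v (n + 1)%nat - v n - D) b2_pos Hlap)
    as [Z [m [td [Ht [HR [H0 [Hm _]]]]]]].
  assert (Ha := alpha_pos b2_pos).
  assert (Htd : forall n, Z (td n) = (a1 * v n, - mu)).
  { intros n. rewrite <- (Rplus_0_r (td n)), (returns_up _ _ _ _ HR), flow_0 by lra.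
    reflexivity. }
  destruct (cycle_start b2_pos Zc mc _ _ HC) as [Z0 m0].
  assert (Hstart : starts_near Zc mc d Z m).
  { exists 0. split; [lra|]. split.
    - rewrite Z0, <- H0, Htd. apply ball_RR. simpl. split.
      + replace (a1 * (V - eta) - a1 * V) with (- (a1 * eta)) by ring.
        rewrite Rabs_Ropp, Rabs_mult, (Rabs_right eta) by lra.
        replace (Rabs a1 * eta) with (d / 2) by (unfold eta; field; lra). lra.
      + rewrite Rminus_diag, Rabs_R0. lra.
    - rewrite m0, <- H0, <- (Rplus_0_r (td 0%nat)). apply Hm. lra. }
  destruct (visible_growth v Hneg Hrec (proj1 (Hinv 0%nat))) as [_ [_ Hunb]].
  destruct (cycle_bounded b2_pos Zc mc _ _ HC) as [M [_ [_ [_ [_ [_ HM]]]]]].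
  destruct (Hunb ((M + 1) / Rabs a1)) as [n Hn].
  destruct (Hnear Z m Ht Hstart (td n) (returns_nonneg b2_pos _ _ _ _ HR n)) as [q [Hq Hball]].
  apply (proj1 (ball_RR _ _ _)) in Hball. rewrite Htd in Hball. simpl in Hball.
  destruct Hball as [Hball _]. destruct (HM q Hq) as [Hqx _].
  apply (Rmult_lt_compat_l (Rabs a1)) in Hn; [|exact Ha1].
  replace (Rabs a1 * ((M + 1) / Rabs a1)) with (M + 1) in Hn by (field; lra).
  assert (E : Rabs a1 * - v n = Rabs (a1 * v n)).
  { specialize (Hneg n). rewrite Rabs_mult, (Rabs_left1 (v n)) by exact Hneg. reflexivity. }
  rewrite E in Hn.
  assert (Htri := Rabs_triang (a1 * v n - fst q) (fst q)).
  replace (a1 * v n - fst q + fst q) with (a1 * v n) in Htri by ring. lra.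
Qed.

(** The other trajectories escape to infinity, so they are not periodic. *)
Lemma visible_isolated Zc mc : is_cycle Zc mc (a1 * V) (- D) -> isolated H Zc.
Proof.
  intros HC. apply isolated_of_attraction. intros Z m HP.
  destruct (visible_trajectories Z m (proj1 HP)) as [H1|[H5|[_ Hom]]].
  - now apply (periodic_not_type1 Z m) in H1.
  - now apply (periodic_not_type5 Z m) in H5.
  - now apply (Hom Zc mc).
Qed.
End Cycle_visible.

Lemma visible_types Z m :
  trajectory H Z m ->
  type1 Z \/ type3 H (visible_fold a1 b1) (invisible_fold a1 b1) Z \/ type5 H Z.
Proof.
  intros Ht. destruct (visible_trajectories Z m Ht) as [H1|[H5|[HV Hom]]]; auto.
  right. left. destruct (cycle_exists b2_pos _ _ (visible_cycle_lap HV)) as [Zc [mc HC]].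
  exists Zc, mc. split; [split|split; [|split]].
  - apply (cycle_periodic b2_pos Zc mc _ _ HC).
  - now apply (visible_isolated Zc mc).
  - apply (cycle_meets_HB b2_pos Zc mc _ _ HC).
  - now apply (Hom Zc mc).
  - right. split; [exact fold_visible|]. now apply visible_unstable.
Qed.
End Leftward.
End Visible.
End Scaled.

(** * Vertical arcs and the classification *)

Section Vertical.
Hypothesis a1_zero : a1 = 0.
Hypothesis b2_pos : 0 < b2.

(** The descent has the constant speed [b1 * (w + delta)]. *)
Lemma vertical_lap w beta w' :
  lap w beta w' <->
  w' = w + delta /\ b1 * (w + delta) < 0 /\ beta = 2 * mu / - (b1 * (w + delta)).
Proof.
  assert (EF : forall t, flow Plus (w + delta, mu) t = (w + delta, mu + b1 * (w + delta) * t)).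
  { intros t. simpl. rewrite a1_zero. f_equal; field. }
  unfold lap. rewrite EF. split.
  - intros [Hb [_ Hend]]. injection Hend as E1 E2.
    assert (Hneg : b1 * (w + delta) < 0) by nra.
    split; [now symmetry|]. split; [exact Hneg|].
    apply (Rmult_eq_reg_r (- (b1 * (w + delta)))); [|lra].
    unfold Rdiv. rewrite Rmult_assoc, Rinv_l; lra.
  - intros [-> [Hneg Eb]].
    assert (Hb : 0 < beta) by (rewrite Eb; apply Rdiv_lt_0_compat; lra).
    assert (E : b1 * (w + delta) * beta = - (2 * mu)).
    { rewrite Eb. set (k := b1 * (w + delta)) in *. field. lra. }
    split; [exact Hb|]. split.
    + intros t Ht. rewrite EF. simpl snd. nra.
    + f_equal. lra.
Qed.

Lemma vertical_escape Z td w beta :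
  returns Z td w beta -> delta <> 0 -> type5 H Z.
Proof.
  intros HR Hd.
  assert (Hl := fun n => proj1 (vertical_lap _ _ _) (returns_lap _ _ _ _ HR n)).
  pose (sg := if Rlt_dec 0 delta then 1 else -1).
  assert (Hsg : (sg = 1 \/ sg = -1) /\ 0 < sg * delta).
  { unfold sg. destruct (Rlt_dec 0 delta); split; auto; lra. }
  destruct Hsg as [Hsg Hpos].
  assert (Hw : forall n, sg * w 0%nat + INR n * (sg * delta) = sg * w n).
  { induction n as [|n IH]; [simpl; ring|]. rewrite S_INR, <- Nat.add_1_r, (proj1 (Hl n)).
    rewrite Rmult_plus_distr_l, <- IH. ring. }
  apply (zigzag_type5 b2_pos Z td w beta sg HR Hsg).
  - intros n t Ht. destruct (Hl n) as [_ [Hneg _]]. simpl. rewrite a1_zero. nra.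
  - intros n. rewrite (proj1 (Hl n)). lra.
  - intros M. assert (Hlim := is_lim_seq_affine (sg * w 0%nat) _ Hpos).
    apply is_lim_seq_spec in Hlim. destruct (Hlim M) as [n Hn]. exists n.
    rewrite <- Hw. apply Hn. lia.
Qed.

(** All the orbits through [L^-] near this one are vertical segments too. *)
Lemma vertical_not_isolated w beta Zc mc :
  delta = 0 -> is_cycle Zc mc w beta -> ~ isolated H Zc.
Proof.
  intros Hd HC [eps [Heps Hiso]].
  destruct (proj1 (vertical_lap _ _ _) (cycle_lap Zc mc _ _ HC)) as [_ [Hneg _]].
  assert (Ha := alpha_pos b2_pos).
  assert (Ha2 : a2 = 0).
  { unfold delta in Hd. apply Rmult_integral in Hd. destruct Hd; [assumption|lra]. }
  rewrite Hd, Rplus_0_r in Hneg.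
  assert (Hw0 : w <> 0) by (intros ->; lra).
  assert (Hx : forall v b Z m t, is_cycle Z m v b -> 0 <= t ->
            fst (Z t) = v /\ - mu <= snd (Z t) <= mu).
  { intros v b Z m t HC' Ht.
    assert (Hlap := cycle_lap Z m _ _ HC').
    destruct (proj1 (vertical_lap _ _ _) Hlap) as [_ [Hneg' _]].
    destruct (cycle_cases b2_pos Z m _ _ HC' t Ht) as [[_ [s [Hs ->]]]|[_ [s [Hs ->]]]].
    - simpl. rewrite Ha2. split; [ring|].
      assert (Hba : b2 * alpha = 2 * mu) by (unfold alpha; field; lra).
      assert (b2 * s <= b2 * alpha) by (apply Rmult_le_compat_l; lra). nra.
    - destruct Hlap as [_ [Hlow _]]. specialize (Hlow s Hs). simpl in Hlow |- *.
      rewrite a1_zero in *. split; [lra|]. nra. }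
  pose (k := eps / 2 / Rabs w). assert (Hk0 := Rabs_pos_lt w Hw0).
  assert (Hk : 0 < k) by (unfold k; apply Rdiv_lt_0_compat; lra).
  pose (w' := w * (1 + k)).
  assert (Hlap' : lap w' (2 * mu / - (b1 * (w' + delta))) w').
  { apply vertical_lap. rewrite Hd, Rplus_0_r. split; [reflexivity|]. split; [|reflexivity].
    unfold w'. nra. }
  destruct (cycle_exists b2_pos _ _ Hlap') as [Z' [m' HC']].
  assert (Heq := Hiso Z' m' (cycle_periodic b2_pos Z' m' _ _ HC')).
  assert (Horb : orbit Zc (w', - mu)).
  { apply Heq.
    - intros p [t [Ht <-]]. destruct (Hx _ _ _ _ t HC' Ht) as [E1 E2].
      exists (flow Minus (w, - mu) ((snd (Z' t) + mu) / b2)). split.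
      + apply (cycle_orbit_up Zc mc _ _ HC). unfold alpha. split.
        * apply Rdiv_le_0_compat; lra.
        * unfold Rdiv. apply Rmult_le_compat_r; [|lra]. apply Rlt_le, Rinv_0_lt_compat. lra.
      + apply ball_RR. simpl. rewrite E1, Ha2. split.
        * replace (w' - (w + 0 * ((snd (Z' t) + mu) / b2))) with (w * k) by (unfold w'; ring).
          rewrite Rabs_mult, (Rabs_right k) by lra.
          replace (Rabs w * k) with (eps / 2) by (unfold k; field; lra). lra.
        * replace (snd (Z' t) - (- mu + b2 * ((snd (Z' t) + mu) / b2))) with 0 by (field; lra).
          rewrite Rabs_R0. lra.
    - exists 0. split; [lra|]. apply (cycle_start b2_pos Z' m' _ _ HC'). }
  destruct Horb as [t [Ht E]]. destruct (Hx _ _ _ _ t HC Ht) as [E1 _].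
  rewrite E in E1. simpl in E1. unfold w' in E1. nra.
Qed.

Lemma vertical_type4 Z td w beta : returns Z td w beta -> delta = 0 -> type4 H Z.
Proof.
  intros HR Hd.
  assert (Hl := fun n => proj1 (vertical_lap _ _ _) (returns_lap _ _ _ _ HR n)).
  assert (Hw : forall n, w n = w 0%nat).
  { induction n as [|n IH]; [reflexivity|].
    rewrite <- Nat.add_1_r, (proj1 (Hl n)), Hd, IH. ring. }
  assert (Hb : forall n, beta n = beta 0%nat).
  { intros n. rewrite (proj2 (proj2 (Hl n))), (proj2 (proj2 (Hl 0%nat))), Hw. reflexivity. }
  assert (Hlap : lap (w 0%nat) (beta 0%nat) (w 0%nat)).
  { assert (L := returns_lap _ _ _ _ HR 0). now rewrite (Hw (0 + 1)%nat) in L. }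
  destruct (cycle_exists b2_pos _ _ Hlap) as [Zc [mc HC]].
  exists Zc, mc. split; [|split; [|split]].
  - apply (cycle_periodic b2_pos Zc mc _ _ HC).
  - now apply (vertical_not_isolated (w 0%nat) (beta 0%nat) Zc mc).
  - apply (cycle_meets_HB b2_pos Zc mc _ _ HC).
  - apply (convergence_to_cycle b2_pos Zc mc _ _ HC Z td w beta HR).
    + apply (is_lim_seq_ext (fun _ => w 0%nat)); [|apply is_lim_seq_const]. now intros n.
    + apply (is_lim_seq_ext (fun _ => beta 0%nat)); [|apply is_lim_seq_const]. now intros n.
Qed.
End Vertical.

Lemma upward_types Z m :
  0 < b2 -> a1 ^ 2 + b1 ^ 2 <> 0 -> trajectory H Z m -> ~ comes_to_rest Z ->
  type1 Z \/ type2 Z \/ type3 H (visible_fold a1 b1) (invisible_fold a1 b1) Z \/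
  type4 H Z \/ type5 H Z.
Proof.
  intros Hb2 Hne Ht Hrest.
  destruct (trajectory_dichotomy Hb2 Z m Ht) as [Hab|[td [w [beta HR]]]].
  { destruct (above_forever_type Z Hne Hab) as [|[[_ H2]|[_ Hr]]]; tauto. }
  destruct (Req_dec a1 0) as [Ha1|Ha1].
  { destruct (Req_dec delta 0) as [Hd|Hd].
    - do 3 right. left. now apply (vertical_type4 Ha1 Hb2 Z td w beta).
    - do 4 right. now apply (vertical_escape Ha1 Hb2 Z td w beta). }
  destruct (Rtotal_order (a1 * b1) 0) as [Hinv|[Hzero|Hvis]].
  - destruct (Rlt_le_dec (delta / a1) 0) as [HD|HD].
    + do 2 right. left. now apply (invisible_limit_cycle Ha1 Hb2 Hinv HD Z m).
    + do 4 right. now apply (invisible_escape Ha1 Hb2 Hinv Z td w beta).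
  - exfalso. destruct (returns_lap _ _ _ _ HR 0) as [_ [_ Hend]].
    apply (f_equal snd) in Hend. simpl in Hend.
    replace b1 with 0 in Hend by (apply Rmult_integral in Hzero; lra). lra.
  - destruct (Rlt_le_dec (delta / a1) 0) as [HD|HD].
    + destruct (visible_types Ha1 Hb2 Hvis HD Z m Ht) as [|[|]]; tauto.
    + exfalso. exact (visible_no_returns Ha1 Hvis Z td w beta HD HR).
Qed.

Lemma downward_types Z m :
  b2 <= 0 -> a1 ^ 2 + b1 ^ 2 <> 0 -> a2 ^ 2 + b2 ^ 2 <> 0 ->
  trajectory H Z m -> ~ comes_to_rest Z -> type1 Z \/ type2 Z.
Proof.
  intros Hb2 Hne1 Hne2 Ht Hrest. pose proof (proj1 Ht) as HZ.
  destruct (trajectory_run Z m Ht) as [Hr Hy].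
  assert (Hminus : forall a, 0 <= a -> run Minus Z a -> type1 Z \/ type2 Z).
  { intros a Ha Hra. apply (minus_forever_type Z a Hne2).
    now apply run_minus_forever. }
  destruct (m 0); [|now apply (Hminus 0); [lra|]].
  destruct (run_plus_step Z 0 HZ (Rle_refl 0) Hr ltac:(lra)) as [Hab|[r [Hr0 [_ [_ [_ Hra]]]]]].
  - destruct (above_forever_type Z Hne1 Hab) as [|[[_ H2]|[_ Hre]]]; tauto.
  - apply (Hminus (0 + r)); [lra|exact Hra].
Qed.
End Family.

Theorem theorem1 (mu a1 b1 a2 b2 : R) (hmu : 0 < mu)
    (h1 : a1 ^ 2 + b1 ^ 2 <> 0) (h2 : a2 ^ 2 + b2 ^ 2 <> 0)
    (x0 y0 : R) (Z : R -> R * R) (m : R -> side)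
    (hZ : trajectory (fold_constant mu a1 b1 a2 b2) Z m)
    (hZ0 : Z 0 = (x0, y0))
    (hrest : ~ comes_to_rest Z) :
  type1 Z \/
  type2 Z \/
  type3 (fold_constant mu a1 b1 a2 b2)
    (visible_fold a1 b1) (invisible_fold a1 b1) Z \/
  type4 (fold_constant mu a1 b1 a2 b2) Z \/
  type5 (fold_constant mu a1 b1 a2 b2) Z.
Proof.
  destruct (Rlt_le_dec 0 b2) as [Hb2|Hb2].
  - now apply (upward_types mu a1 b1 a2 b2 hmu Z m).
  - destruct (downward_types mu a1 b1 a2 b2 hmu Z m Hb2 h1 h2 hZ hrest); tauto.
Qed.
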